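(* Let $(\mathfrak{S},\mathbb{P})$ be a random iterated function system on $\mathbb{R}^d$ that satisfies the uniform strong separation condition, with associated random attractors $K_\omega$ and random self-similar measures $\mu_\omega$. Then for $\mathbb{P}$-almost all $\omega\in\Omega$, $$[\underline{\alpha},\overline{\alpha}]=\{\dim_{loc}\mu_\omega(x): x\in K_\omega\}=\{\underline{\dim}_{loc}\mu_\omega(x): x\in K_\omega\}=\{\overline{\dim}_{loc}\mu_\omega(x): x\in K_\omega\},$$ where the first set is taken over those $x$ for which the local dimension exists. If $\alpha\in(\underline{\alpha},\overline{\alpha})$, then there is some $q_\alpha\in\mathbb{R}$ such that $\alpha=-\beta'(q_\alpha)$ and, for almost all $\omega$, $$\dim_H E_{\omega,\alpha}=\inf_{q\in\mathbb{R}}(\beta(q)+\alpha q)=\beta(q_\alpha)-\beta'(q_\alpha)q_\alpha=\dim_H\underline{E_{\omega,\alpha}}=\dim_H\overline{E_{\omega,\alpha}}.$$ Moreover, the function $\beta$ is convex.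
   Context: Setting. Let $m\in\mathbb{N}$, $\mathcal{A}=\{1,\dots,m\}$, $\Omega=\mathcal{A}^{\mathbb{N}}$, and let $\mathbb{P}$ be the Bernoulli product probability measure on $\Omega$ giving weight $\theta_j>0$ to letter $j$, $\sum_j\theta_j=1$. For each $j$ let $\mathfrak{S}_j=\{S_{j,k}:k\in\mathcal{I}_j\}$, $\mathcal{I}_j=\{0,1,\dots,\mathcal{N}(j)\}$, be a finite family of similitudes of $\mathbb{R}^d$ with contraction ratios $0<r_{j,k}<1$. The pair $(\mathfrak{S},\mathbb{P})$, $\mathfrak{S}=\{\mathfrak{S}_1,\dots,\mathfrak{S}_m\}$, is a random iterated function system (RIFS). Write $\mathfrak{S}_j(K)=\bigcup_{k\in\mathcal{I}_j}S_{j,k}(K)$. For $\omega=(\omega_1,\omega_2,\dots)\in\Omega$ the random attractor is $K_\omega=\lim_n\mathfrak{S}_{\omega_1}\circ\dots\circ\mathfrak{S}_{\omega_n}(K)$ (Hausdorff metric; any non-empty compact $K$). Fix $p_{j,k}>0$ with $\sum_{k\in\mathcal{I}_j}p_{j,k}=1$ for each $j$; the random self-similar measures $\mu_\omega$ are the unique Borel probability measures, $\mu_\omega$ supported on $K_\omega$, with $\mu_\omega(E)=\sum_{k\in\mathcal{I}_{\omega_1}}p_{\omega_1,k}\,\mu_{\omega_2\omega_3\dots}(S_{\omega_1,k}^{-1}(E))$ for all Borel $E$ and all $\omega$. Uniform strong separation condition (USSC): let $K$ be the smallest non-empty compact subset of $\mathbb{R}^d$ with $S_{j,k}(K)\subseteq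 K$ for all $j,k$; there is $\epsilon>0$ such that $|S_{j,k_1}(x)-S_{j,k_2}(y)|\ge\epsilon$ for all $j$, all $k_1\ne k_2$ in $\mathcal{I}_j$ and all $x,y\in K$. Local dimensions: $\overline{\dim}_{loc}\mu(x)=\limsup_{\varepsilon\to0^+}\frac{\log\mu(B(x,\varepsilon))}{\log\varepsilon}$, $\underline{\dim}_{loc}\mu(x)$ is the corresponding $\liminf$, and $\dim_{loc}\mu(x)$ is the limit when it exists. $E_{\omega,\alpha}$, $\overline{E_{\omega,\alpha}}$, $\underline{E_{\omega,\alpha}}$ are the sets of $x\in K_\omega$ at which respectively $\dim_{loc}\mu_\omega(x)$, $\overline{\dim}_{loc}\mu_\omega(x)$, $\underline{\dim}_{loc}\mu_\omega(x)$ equals $\alpha$. $\dim_H$ is Hausdorff dimension. $\overline{\alpha}=\max\frac{\log\prod_{j=1}^m p_{j,k_j}^{\theta_j}}{\log\prod_{j=1}^m r_{j,k_j}^{\theta_j}}$ and $\underline{\alpha}=\min\frac{\log\prod_{j=1}^m p_{j,k_j}^{\theta_j}}{\log\prod_{j=1}^m r_{j,k_j}^{\theta_j}}$, over all $(k_1,\dots,k_m)\in\prod_j\mathcal{I}_j$. For $q\in\mathbb{R}$, $\beta(q)$ is the unique real number with $\sum_{j=1}^m\theta_j\log\sum_{k\in\mathcal{I}_j}p_{j,k}^q r_{j,k}^{\beta(q)}=0$ (a differentiable function of $q$). *)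

(* Defs.v *)
From HB Require Import structures.
From mathcomp Require Import all_boot all_order all_algebra.
From mathcomp Require Import all_classical all_reals all_analysis.
Set Implicit Arguments.
Unset Strict Implicit.
Unset Printing Implicit Defensive.
Import Order.TTheory GRing.Theory Num.Theory.
Import numFieldNormedType.Exports.
Local Open Scope classical_set_scope.
Local Open Scope ring_scope.

(* The library norm on ['rV_d] is the sup norm; it induces the same topology
   (hence the same compact and Borel sets), but similitudes, balls and
   diameters are Euclidean. *)
Definition enorm (R : realType) (d : nat) (x : 'rV[R]_d) : R :=
  Num.sqrt (\sum_(i < d) x ord0 i ^+ 2).

Definition cball (R : realType) (d : nat) (x : 'rV[R]_d) (e : R)
  : set 'rV[R]_d := [set y | enorm (y - x) <= e].

Notation borelRd R d := (g_sigma_algebraType (@open 'rV[R]_d)).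

Definition hausdorff_dist (R : realType) (d : nat) (A B : set 'rV[R]_d) : R :=
  inf [set e : R | [/\ 0 <= e,
    (forall x, A x -> exists2 y, B y & enorm (x - y) <= e) &
    (forall y, B y -> exists2 x, A x & enorm (x - y) <= e)]].

(* [diam set0 = -oo]. *)
Definition diam (R : realType) (d : nat) (A : set 'rV[R]_d) : \bar R :=
  ereal_sup [set (enorm (x - y))%:E | x in A & y in A].

(* [diam A ^ s], with value 0 at the empty set and [0 ^ 0 = 1], so that for
   [s = 0] the Hausdorff measure below is the counting measure. *)
Definition diam_pow (R : realType) (d : nat) (s : R) (A : set 'rV[R]_d)
  : \bar R := if A == set0 then 0%E else poweR (diam A) s.

Definition hausdorff_pre (R : realType) (d : nat) (s delta : R)
    (E : set 'rV[R]_d) : \bar R :=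
  ereal_inf [set (\sum_(i <oo) diam_pow s (U i))%E |
    U in [set U : (set 'rV[R]_d)^nat |
      E `<=` \bigcup_i U i /\ forall i, (diam (U i) <= delta%:E)%E]].

Definition hausdorff_meas (R : realType) (d : nat) (s : R)
    (E : set 'rV[R]_d) : \bar R :=
  ereal_sup [set hausdorff_pre s delta E | delta in [set t : R | 0 < t]].

Definition hausdorff_dim (R : realType) (d : nat) (E : set 'rV[R]_d) : \bar R :=
  ereal_inf [set s%:E | s in [set s : R | 0 <= s /\ hausdorff_meas s E = 0%E]].

(* [lne 0 = -oo], so the quotient tends to [+oo] off the support. *)
Definition log_quotient (R : realType) (d : nat) (mu : set 'rV[R]_d -> \bar R)
    (x : 'rV[R]_d) (e : R) : \bar R :=
  (lne (mu (cball x e)) * ((ln e)^-1)%:E)%E.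

Definition upper_local_dim (R : realType) (d : nat)
    (mu : set 'rV[R]_d -> \bar R) (x : 'rV[R]_d) : \bar R :=
  limf_esup (log_quotient mu x) (0 : R)^'+.

Definition lower_local_dim (R : realType) (d : nat)
    (mu : set 'rV[R]_d -> \bar R) (x : 'rV[R]_d) : \bar R :=
  limf_einf (log_quotient mu x) (0 : R)^'+.

Definition has_local_dim (R : realType) (d : nat)
    (mu : set 'rV[R]_d -> \bar R) (x : 'rV[R]_d) (a : \bar R) : Prop :=
  log_quotient mu x e @[e --> (0 : R)^'+] --> a.

Definition level_set (R : realType) (d : nat) (mu : set 'rV[R]_d -> \bar R)
    (K : set 'rV[R]_d) (alpha : R) : set 'rV[R]_d :=
  [set x | K x /\ has_local_dim mu x alpha%:E].

Definition upper_level_set (R : realType) (d : nat)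
    (mu : set 'rV[R]_d -> \bar R) (K : set 'rV[R]_d) (alpha : R)
  : set 'rV[R]_d := [set x | K x /\ upper_local_dim mu x = alpha%:E].

Definition lower_level_set (R : realType) (d : nat)
    (mu : set 'rV[R]_d -> \bar R) (K : set 'rV[R]_d) (alpha : R)
  : set 'rV[R]_d := [set x | K x /\ lower_local_dim mu x = alpha%:E].

(* The alphabet {1, ..., m} is ['I_m.+1] (with [m.+1] letters), since
   measurable types must be inhabited; words are indexed from 0. *)
HB.instance Definition _ (m : nat) := isPointed.Build 'I_m.+1 ord0.

Definition cylinder (m : nat) (w : seq 'I_m.+1) : set (nat -> 'I_m.+1) :=
  [set omega | mkseq omega (size w) = w].

Notation words m := (g_sigma_algebraType (range (@cylinder m))).

Definition is_bernoulli (R : realType) (m : nat) (theta : 'I_m.+1 -> R)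
    (P : probability (words m) R) : Prop :=
  forall w : seq 'I_m.+1, P (cylinder w) = (\prod_(j <- w) theta j)%:E.

Definition shift (m : nat) (omega : nat -> 'I_m.+1) : nat -> 'I_m.+1 :=
  fun n => omega n.+1.

Definition similitude (R : realType) (d : nat) (r : R)
    (f : 'rV[R]_d -> 'rV[R]_d) : Prop :=
  forall x y, enorm (f x - f y) = r * enorm (x - y).

(* The index set {0, ..., N j} is ['I_(N j).+1]. *)
Definition ifs_image (R : realType) (d m : nat) (N : 'I_m.+1 -> nat)
    (S : forall j, 'I_(N j).+1 -> 'rV[R]_d -> 'rV[R]_d) (j : 'I_m.+1)
    (C : set 'rV[R]_d) : set 'rV[R]_d :=
  \bigcup_k (S j k @` C).

Definition is_random_attractor (R : realType) (d m : nat) (N : 'I_m.+1 -> nat)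
    (S : forall j, 'I_(N j).+1 -> 'rV[R]_d -> 'rV[R]_d)
    (K : (nat -> 'I_m.+1) -> set 'rV[R]_d) : Prop :=
  forall omega, [/\ K omega !=set0, compact (K omega) &
    forall C : set 'rV[R]_d, C !=set0 -> compact C ->
      hausdorff_dist (foldr (ifs_image S) C (mkseq omega n)) (K omega)
        @[n --> \oo] --> (0 : R)].

Definition is_random_measure (R : realType) (d m : nat) (N : 'I_m.+1 -> nat)
    (S : forall j, 'I_(N j).+1 -> 'rV[R]_d -> 'rV[R]_d)
    (p : forall j, 'I_(N j).+1 -> R)
    (K : (nat -> 'I_m.+1) -> set 'rV[R]_d)
    (mu : (nat -> 'I_m.+1) -> probability (borelRd R d) R) : Prop :=
  (forall omega, mu omega (~` K omega) = 0%E) /\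
  (forall omega (E : set (borelRd R d)), measurable E ->
    mu omega E = (\sum_(k < (N (omega 0%N)).+1)
      (p (omega 0%N) k)%:E * mu (shift omega) (S (omega 0%N) k @^-1` E))%E).

Definition invariant_compact (R : realType) (d m : nat) (N : 'I_m.+1 -> nat)
    (S : forall j, 'I_(N j).+1 -> 'rV[R]_d -> 'rV[R]_d)
    (K : set 'rV[R]_d) : Prop :=
  [/\ K !=set0, compact K & forall j k, S j k @` K `<=` K].

Definition ussc (R : realType) (d m : nat) (N : 'I_m.+1 -> nat)
    (S : forall j, 'I_(N j).+1 -> 'rV[R]_d -> 'rV[R]_d) : Prop :=
  exists K : set 'rV[R]_d,
    [/\ invariant_compact S K,
        (forall K', invariant_compact S K' -> K `<=` K') &
        exists2 eps : R, 0 < eps &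
          forall j (k1 k2 : 'I_(N j).+1), k1 != k2 ->
            forall x y, K x -> K y -> eps <= enorm (S j k1 x - S j k2 y)].

Definition log_ratio (R : realType) (m : nat) (theta : 'I_m.+1 -> R)
    (N : 'I_m.+1 -> nat) (r p : forall j, 'I_(N j).+1 -> R)
    (k : {dffun forall j : 'I_m.+1, 'I_(N j).+1}) : R :=
  ln (\prod_j (p j (k j) `^ theta j)) / ln (\prod_j (r j (k j) `^ theta j)).

Definition dffun0 (m : nat) (N : 'I_m.+1 -> nat)
  : {dffun forall j : 'I_m.+1, 'I_(N j).+1} :=
  [ffun j : 'I_m.+1 => (ord0 : 'I_(N j).+1)].

(* The default of the iterated max/min is one of the values being compared. *)
Definition alpha_max (R : realType) (m : nat) (theta : 'I_m.+1 -> R)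
    (N : 'I_m.+1 -> nat) (r p : forall j, 'I_(N j).+1 -> R) : R :=
  \big[Num.max/log_ratio theta r p (dffun0 N)]_k log_ratio theta r p k.

Definition alpha_min (R : realType) (m : nat) (theta : 'I_m.+1 -> R)
    (N : 'I_m.+1 -> nat) (r p : forall j, 'I_(N j).+1 -> R) : R :=
  \big[Num.min/log_ratio theta r p (dffun0 N)]_k log_ratio theta r p k.

Definition is_beta (R : realType) (m : nat) (theta : 'I_m.+1 -> R)
    (N : 'I_m.+1 -> nat) (r p : forall j, 'I_(N j).+1 -> R)
    (beta : R -> R) : Prop :=
  forall q, \sum_j theta j *
    ln (\sum_(k < (N j).+1) p j k `^ q * r j k `^ beta q) = 0.

(* Main.v *)
(* Points of K_omega are coded by digit sequences k, and by uniform strong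
   separation the ball of radius e about a point has, up to constants, the mass
   P_n = prod_(i < n) p(omega_i, k_i) of the cylinder whose ratio
   R_n = prod_(i < n) r(omega_i, k_i) is comparable to e. Every local dimension
   is thus read off log P_n / log R_n, and the only property of omega that
   matters is that its letters have frequencies theta; this holds almost surely
   by a Chernoff bound and Borel-Cantelli. All that follows is deterministic.

   Codes with prescribed digit statistics come from derandomisation, so that no
   measure on codes is needed: a nonnegative supermartingale g on finite words
   does not increase along some child of each word, hence stays below g(empty)
   along an infinite code. Exponential supermartingales give the law of large
   numbers for the digits; adding the conditional masses of countably many
   cylinders of total mass less than 1/2 gives a code that avoids all of them,
   which is the mass distribution principle for lower bounds on Hausdorff
   measures. The weights used are the Gibbs weights p^q r^beta(q) / Z. The upper
   bounds cover a level set by the cylinders with R^s <= p^q r^(beta(q) + t).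

   The tangent inequality for the pressure makes
   - (mean of log p) / (mean of log r) under the Gibbs weights a subgradient of
   beta. Hence beta is convex, and differentiable since this subgradient is
   continuous; q_alpha is a minimiser of the coercive function
   beta(q) + alpha q. *)
Require Import Defs.
From HB Require Import structures.
From mathcomp Require Import all_boot all_order all_algebra.
From mathcomp Require Import all_classical all_reals all_analysis.
From mathcomp Require Import ring lra.
Set Implicit Arguments.
Unset Strict Implicit.
Unset Printing Implicit Defensive.
Import Order.TTheory GRing.Theory Num.Theory.
Import numFieldNormedType.Exports.
Local Open Scope classical_set_scope.
Local Open Scope ring_scope.

(** * Words, Birkhoff sums and supermartingales *)

(** Every error term has the form [delta * n%:R + C], for all [delta > 0] at once, and the constant
    is quantified before the code. A lower bound on a Hausdorff measure needs one constant for all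
    codes that may be produced when a cover is avoided, so [C] may depend on the weights and on
    omega but not on the code. A single code must moreover be good for every [delta] and avoid every
    cylinder of a cover; this is why countably many supermartingales are added with summable
    coefficients. The almost sure event depends on theta alone, hence serves all alpha. Hausdorff
    dimension is an infimum over [s >= 0], so the value beta(q) + alpha q also has to be shown
    nonnegative. It is, because beta lies above every line of slope [- tuple_ratio k] through the
    origin and alpha lies between two of these ratios. *)

Lemma expR_le_quad (R : realType) (x : R) : `|x| <= 2^-1 ->
  expR x <= 1 + x + 2 * x ^+ 2.
Proof.
rewrite ler_norml => /andP[x1 x2].
have h : 1 - x <= expR (- x) by exact: expR_ge1Dx.
have h0 : 0 < 1 - x by lra.
rewrite -(ler_pM2r (expR_gt0 (- x))) expRxMexpNx_1.
(* As [1 - x] bounds [expR (- x)] from below, the product has only to reach 1; its excess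
   [x ^+ 2 * (1 - 2 * x)] is nonnegative because [x] is at most one half. *)
apply: (@le_trans _ _ ((1 + x + 2 * x ^+ 2) * (1 - x))).
  have -> : (1 + x + 2 * x ^+ 2) * (1 - x) = 1 + x ^+ 2 * (1 - 2 * x) by ring.
  by rewrite lerDl mulr_ge0 ?sqr_ge0//; lra.
by rewrite ler_wpM2l//; have := sqr_ge0 x; lra.
Qed.

(** Averaging the quadratic bound on [expR] kills the linear term, since [x] is centred. This one
    estimate serves the digits of codes as well as the letters of omega. *)
Lemma sum_expR_centered (R : realType) (n : nat) (w x : 'I_n -> R) (F t : R) :
  (forall i, 0 <= w i) -> \sum_i w i = 1 -> \sum_i w i * x i = 0 ->
  (forall i, `|x i| <= F) -> `|t| * F <= 2^-1 ->
  \sum_i w i * expR (t * x i) <= expR (2 * t ^+ 2 * F ^+ 2).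
Proof.
move=> w0 w1 wx xF tF.
apply: (@le_trans _ _ (1 + 2 * t ^+ 2 * F ^+ 2)); last exact: expR_ge1Dx.
have -> : 1 + 2 * t ^+ 2 * F ^+ 2 =
    \sum_i (w i * (1 + 2 * t ^+ 2 * F ^+ 2) + t * (w i * x i)).
  by rewrite big_split/= -mulr_suml -mulr_sumr w1 wx mulr0 addr0 mul1r.
apply: ler_sum => i _.
have -> : w i * (1 + 2 * t ^+ 2 * F ^+ 2) + t * (w i * x i) =
  w i * (1 + t * x i + 2 * t ^+ 2 * F ^+ 2) by ring.
apply: ler_wpM2l => //.
apply: (le_trans (expR_le_quad _)).
  by rewrite normrM (le_trans _ tF)// ler_wpM2l.
rewrite lerD2l -mulrA ler_wpM2l// exprMn ler_wpM2l ?sqr_ge0//.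
by rewrite -real_normK ?num_real// lerXn2r ?nnegrE ?(le_trans _ (xF i)).
Qed.

Lemma expR_decay_le (R : realType) (a b c : R) : 0 < a -> 0 < b -> 0 < c ->
  exists n0, forall n, (n0 <= n)%N -> a * expR (- (c * n%:R)) <= b.
Proof.
move=> a0 b0 c0; exists (Num.truncn (ln (a / b) / c)).+1 => n n0n.
have ab0 : 0 < a / b by rewrite divr_gt0.
rewrite expRN ler_pdivrMr ?expR_gt0// -ler_pdivrMl// mulrC.
rewrite -[leLHS](lnK ab0) ler_expR [leRHS]mulrC -ler_pdivrMr//.
by apply: le_trans (ltW (truncnS_gt _)) _; rewrite ler_nat.
Qed.

Section symbolic.
Variables (R : realType) (m : nat) (N : 'I_m.+1 -> nat).
Implicit Types (f w : forall j, 'I_(N j).+1 -> R) (omega : nat -> 'I_m.+1).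
Implicit Types (u v : seq nat) (k : nat -> nat).

(** The digit type varies with the position, so words are sequences of naturals with a separate
    validity predicate, and [inord] makes the sum total. Recursion from the left along shifts of
    omega matches the self-similarity of the measures. *)
Fixpoint birkhoff f omega u : R :=
  if u is a :: v then f (omega 0%N) (inord a) + birkhoff f (Defs.shift omega) v
  else 0.

Fixpoint valid_word omega u : bool :=
  if u is a :: v then (a <= N (omega 0%N))%N && valid_word (Defs.shift omega) v
  else true.

Definition valid_code omega k := forall n, (k n <= N (omega n))%N.

Lemma mkseq_head (T : Type) (k : nat -> T) n : mkseq k n.+1 = k 0%N :: mkseq (k \o succn) n.
Proof. by rewrite /mkseq /= -[1%N]add1n iotaDl -map_comp. Qed.

Lemma birkhoff_rcons f omega u a : birkhoff f omega (rcons u a) =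
  birkhoff f omega u + f (omega (size u)) (inord a).
Proof.
elim: u omega => [|b u IH] omega /=; first by rewrite addr0 add0r.
by rewrite IH addrA.
Qed.

Lemma valid_word_rcons omega u a : valid_word omega (rcons u a) =
  valid_word omega u && (a <= N (omega (size u)))%N.
Proof.
elim: u omega => [|b u IH] omega /=; first by rewrite andbT.
by rewrite IH andbA.
Qed.

Lemma valid_mkseq omega k n : valid_code omega k -> valid_word omega (mkseq k n).
Proof.
by move=> h; elim: n => // n IH; rewrite mkseqS valid_word_rcons IH size_mkseq h.
Qed.

Lemma birkhoff_mkseq f omega k n : birkhoff f omega (mkseq k n) =
  \sum_(i < n) f (omega i) (inord (k i)).
Proof.
elim: n => [|n IH]; first by rewrite big_ord0.
by rewrite mkseqS birkhoff_rcons size_mkseq IH big_ord_recr.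
Qed.

Lemma birkhoffD f g omega u :
  birkhoff (fun j a => f j a + g j a) omega u =
  birkhoff f omega u + birkhoff g omega u.
Proof.
elim: u omega => [|a u IH] omega /=; first by rewrite addr0.
by rewrite IH addrACA.
Qed.

Lemma birkhoffZ c f omega u :
  birkhoff (fun j a => c * f j a) omega u = c * birkhoff f omega u.
Proof.
elim: u omega => [|a u IH] omega /=; first by rewrite mulr0.
by rewrite IH mulrDr.
Qed.

Lemma ler_birkhoff f g omega u : (forall j a, f j a <= g j a) ->
  birkhoff f omega u <= birkhoff g omega u.
Proof.
move=> fg; elim: u omega => [|a u IH] omega //=.
by rewrite lerD.
Qed.

Lemma eq_birkhoff f g omega u : (forall j a, f j a = g j a) ->
  birkhoff f omega u = birkhoff g omega u.
Proof. by move=> fg; apply/eqP; rewrite eq_le !ler_birkhoff// => j a; rewrite fg. Qed.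

Lemma birkhoff_const c omega u :
  birkhoff (fun _ _ => c) omega u = c * (size u)%:R.
Proof.
elim: u omega => [|a u IH] omega /=; first by rewrite mulr0.
by rewrite IH -[in RHS]nat1r mulrDr mulr1.
Qed.

Lemma birkhoff_letter (h : 'I_m.+1 -> R) omega u :
  birkhoff (fun j _ => h j) omega u = \sum_(i < size u) h (omega i).
Proof.
elim: u omega => [|a u IH] omega /=; first by rewrite big_ord0.
by rewrite IH big_ord_recl.
Qed.

Lemma exists_neg_bound f : (forall j a, f j a < 0) ->
  exists2 c, 0 < c & forall j a, f j a <= - c.
Proof.
move=> f0.
pose c : R := - \big[Num.max/f ord0 ord0]_j \big[Num.max/f j ord0]_k f j k.
exists c => [|j a].
  by rewrite oppr_gt0; apply: bigmax_lt => // j _; apply: bigmax_lt.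
rewrite opprK.
by apply: (le_trans (le_bigmax _ _ a)); apply: (le_trans _ (le_bigmax _ _ j)).
Qed.

Fixpoint words_of omega n : seq (seq nat) :=
  if n is n'.+1 then
    [seq a :: v | a <- iota 0 (N (omega 0%N)).+1, v <- words_of (Defs.shift omega) n']
  else [:: [::]].

Lemma words_ofS omega n : words_of omega n.+1 =
  [seq a :: v | a <- iota 0 (N (omega 0%N)).+1, v <- words_of (Defs.shift omega) n].
Proof. by []. Qed.

Lemma mem_words_of omega n u :
  (u \in words_of omega n) = (size u == n) && valid_word omega u.
Proof.
elim: n omega u => [|n IH] omega u; first by case: u.
rewrite words_ofS; apply/allpairsPdep/idP.
  move=> [a [v [ai vn ->]]]; rewrite mem_iota add0n ltnS leq0n /= in ai.
  by rewrite /= eqSS andbCA ai /= -IH.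
case: u => [//|a v] /=; rewrite eqSS andbCA -IH => /andP[aN vn].
exists a, v; rewrite vn; split; [|by []|by []].
  by rewrite -[_ :: _]/(iota 0 (N (omega 0%N)).+1) mem_iota add0n ltnS leq0n.
Qed.

Lemma sum_iota_ord n (F : nat -> R) (G : 'I_n.+1 -> R) :
  (forall a : 'I_n.+1, F a = G a) -> \sum_(a <- iota 0 n.+1) F a = \sum_a G a.
Proof.
move=> FG; rewrite -[iota 0 n.+1]/(index_iota 0 n.+1) big_mkord.
by apply: eq_bigr => i _; rewrite FG.
Qed.

(** Distributivity over the digits; it turns the sum over a cover by cylinders into a product of
    partition functions. *)
Lemma sum_words_expR_birkhoff f omega n :
  \sum_(u <- words_of omega n) expR (birkhoff f omega u) =
  \prod_(i < n) \sum_(a < (N (omega i)).+1) expR (f (omega i) a).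
Proof.
elim: n omega => [|n IH] omega.
  by rewrite big_ord0 /= big_cons big_nil addr0 expR0.
rewrite big_ord_recl words_ofS big_allpairs_dep.
under eq_bigr do under eq_bigr do rewrite expRD.
under eq_bigr do rewrite -mulr_sumr IH.
rewrite -mulr_suml; congr (_ * _).
by apply: sum_iota_ord => a; rewrite inord_val.
Qed.

Section supermartingales.
Variables (w : forall j, 'I_(N j).+1 -> R).
Arguments w : clear implicits.
Hypothesis w_ge0 : forall j a, 0 <= w j a.
Hypothesis w_sum : forall j, \sum_a w j a = 1.
Variable (omega : nat -> 'I_m.+1).
Local Open Scope ereal_scope.

(** Values in [\bar R] let countable sums be formed without any convergence argument. *)
Definition supermartingale (g : seq nat -> \bar R) :=
  (forall u, 0 <= g u) /\
  (forall u, \sum_(a < (N (omega (size u))).+1) (w _ a)%:E * g (rcons u a) <= g u).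

Lemma supermartingale_series (g : nat -> seq nat -> \bar R) :
  (forall i, supermartingale (g i)) ->
  supermartingale (fun u => \sum_(i <oo) g i u).
Proof.
move=> sg; split=> u.
  by apply: nneseries_ge0 => i _ _; exact: (sg i).1.
under eq_bigr => a _.
  rewrite -nneseriesZl; last by move=> i _; exact: (sg i).1.
  over.
rewrite -nneseries_sum; last first.
  by move=> a i _; rewrite mule_ge0// ?lee_fin ?w_ge0// (sg i).1.
apply: lee_nneseries => i _ //; last exact: (sg i).2.
by rewrite sume_ge0// => a _; rewrite mule_ge0// ?lee_fin ?w_ge0// (sg i).1.
Qed.

Lemma supermartingaleD g1 g2 : supermartingale g1 -> supermartingale g2 ->
  supermartingale (fun u => g1 u + g2 u).
Proof.
move=> [g10 s1] [g20 s2]; split=> u; first by rewrite adde_ge0.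
under eq_bigr do rewrite ge0_muleDr//.
by rewrite big_split leeD.
Qed.

Lemma supermartingaleZ (c : R) g : (0 <= c)%R -> supermartingale g ->
  supermartingale (fun u => c%:E * g u).
Proof.
move=> c0 [g0 s]; split=> u; first by rewrite mule_ge0.
under eq_bigr do rewrite muleCA.
by rewrite -ge0_sume_distrr ?lee_wpmul2l ?lee_fin// => a _; rewrite mule_ge0// ?lee_fin.
Qed.

(* Some child of each word has at most the value of the word, by averaging. *)
Lemma supermartingale_code g : supermartingale g ->
  exists2 k, valid_code omega k & forall n, g (mkseq k n) <= g [::].
Proof.
move=> [g0 sg].
have next u : {a : nat | (a <= N (omega (size u)))%N /\ g (rcons u a) <= g u}.
  apply: cid.
  pose G := fun a : 'I_(N (omega (size u))).+1 => g (rcons u a).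
  pose b := [arg min_(a < ord0) G a]%O.
  have bP a : G b <= G a by rewrite /b; case: arg_minP => // i _; apply.
  exists b; split; first by rewrite -ltnS.
  apply: le_trans (sg u).
  have -> : g (rcons u b) = \sum_(a < (N (omega (size u))).+1) (w _ a)%:E * G b.
    rewrite -ge0_sume_distrl; last by move=> a _; rewrite lee_fin.
    by rewrite sumEFin w_sum mul1e.
  by apply: lee_sum => a _; rewrite lee_wpmul2l ?lee_fin//; exact: bP.
pose W := fix W n := if n is n'.+1 then rcons (W n') (sval (next (W n'))) else [::].
pose k n := sval (next (W n)).
have WE n : mkseq k n = W n by elim: n => // n IH; rewrite mkseqS IH.
have sW n : size (W n) = n by elim: n => //= n IH; rewrite size_rcons IH.
exists k => n.
  by rewrite -[in N _](sW n); have [] := svalP (next (W n)).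
rewrite WE; elim: n => //= n IH; apply: le_trans IH.
by have [_] := svalP (next (W n)).
Qed.

End supermartingales.

(* [cyl_mass w omega v u] is the conditional mass, given the cylinder of [u],
   of the cylinder of [v] under the product measure with weights [w]. *)
Fixpoint cyl_mass w omega v u : R :=
  match v, u with
  | [::], _ => 1
  | a :: v', [::] =>
    (if (a <= N (omega 0%N))%N then w (omega 0%N) (inord a) else 0) *
      cyl_mass w (Defs.shift omega) v' [::]
  | a :: v', b :: u' => if a == b then cyl_mass w (Defs.shift omega) v' u' else 0
  end.

Lemma cyl_mass_ge0 w omega v u : (forall j a, 0 <= w j a) ->
  0 <= cyl_mass w omega v u.
Proof.
move=> w0; elim: v omega u => [|a v IH] omega [|b u] //=.
  by rewrite mulr_ge0//; case: ifP.
by case: eqP.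
Qed.

Lemma cyl_mass_prefix w omega v u : cyl_mass w omega v (v ++ u) = 1.
Proof. by elim: v omega => [|a v IH] omega //=; rewrite eqxx. Qed.

Lemma cyl_mass_le w f omega v : (forall j a, 0 <= w j a <= expR (f j a)) ->
  cyl_mass w omega v [::] <= expR (birkhoff f omega v).
Proof.
move=> wf; elim: v omega => [|a v IH] omega /=; first by rewrite expR0.
rewrite expRD ler_pM ?cyl_mass_ge0//.
- by case: ifP => // _; have /andP[] := wf _ (inord a : 'I_(N (omega 0%N)).+1).
- by move=> j b; have /andP[] := wf _ b.
- case: ifP => [_|_]; last exact: expR_ge0.
  by have /andP[] := wf _ (inord a : 'I_(N (omega 0%N)).+1).
Qed.

(** If [u] extends [v], the weights sum to 1; if [u] is a proper prefix of [v], at most one child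
    contributes; after a divergence every term is 0. *)
Lemma cyl_mass_rcons w omega v u : (forall j a, 0 <= w j a) ->
  (forall j, \sum_a w j a = 1) ->
  \sum_(a < (N (omega (size u))).+1) w _ a * cyl_mass w omega v (rcons u a)
    <= cyl_mass w omega v u.
Proof.
move=> w0 w1; elim: u omega v => [|b u IH] omega [|c v] /=.
- by under eq_bigr do rewrite mulr1; rewrite w1.
- have [cN|cN] := boolP (c <= N (omega 0%N))%N; last first.
    rewrite mul0r big1// => a _; case: eqP => [ca|]; last by rewrite mulr0.
    by rewrite ca -ltnS ltn_ord in cN.
  rewrite (bigD1 (inord c))//= big1 ?addr0.
    by rewrite inordK ?ltnS// eqxx; case: (v).
  move=> a /eqP ac; case: eqP => [ca|]; last by rewrite mulr0.
  by case: ac; rewrite ca inord_val.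
- by under eq_bigr do rewrite mulr1; rewrite w1.
- case: eqP => _; first exact: (IH (Defs.shift omega)).
  by under eq_bigr do rewrite mulr0; rewrite big1.
Qed.

End symbolic.

(** * Codes with prescribed digit statistics *)

Section good_codes.
Variables (R : realType) (m : nat) (N : 'I_m.+1 -> nat).
Variables (w : forall j, 'I_(N j).+1 -> R).
Arguments w : clear implicits.
Hypothesis w_ge0 : forall j a, 0 <= w j a.
Hypothesis w_sum : forall j, \sum_a w j a = 1.
Implicit Types (f : forall j, 'I_(N j).+1 -> R) (omega : nat -> 'I_m.+1).

Definition wmean f j : R := \sum_a w j a * f j a.

(** The summand 1 keeps the bound positive, so that it can be divided by even when [f] vanishes. *)
Definition fbound f : R := 1 + \sum_j \sum_a `|f j a|.

Lemma fbound_gt0 f : 0 < fbound f.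
Proof. by rewrite ltr_wpDr// sumr_ge0// => j _; rewrite sumr_ge0. Qed.

Lemma le_fbound f j a : `|f j a| <= fbound f.
Proof.
rewrite /fbound (bigD1 j)//= (bigD1 a)//=.
set A := \sum_(_ < _ | _) _; set B := \sum_(_ < _ | _) _.
have A0 : 0 <= A by exact: sumr_ge0.
have B0 : 0 <= B by apply: sumr_ge0 => i _; exact: sumr_ge0.
by lra.
Qed.

Lemma le_wmean_fbound f j : `|wmean f j| <= fbound f.
Proof.
apply: (le_trans (ler_norm_sum _ _ _)).
rewrite -[leRHS]mul1r -(w_sum j) mulr_suml ler_sum// => a _.
by rewrite normrM ger0_norm// ler_wpM2l// le_fbound.
Qed.

Definition centered f j a : R := f j a - wmean f j.
Arguments centered : clear implicits.

Lemma centered_bound f j (a : 'I_(N j).+1) : `|centered f j a| <= 2 * fbound f.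
Proof.
rewrite (le_trans (ler_normB _ _))// mulr2n mulrDl mul1r lerD//.
  exact: le_fbound.
exact: le_wmean_fbound.
Qed.

Lemma sum_centered f j : \sum_a w j a * centered f j a = 0.
Proof.
under eq_bigr do rewrite mulrBr.
by rewrite sumrB -mulr_suml w_sum mul1r subrr.
Qed.

Lemma birkhoff_centered f omega u : birkhoff f omega u =
  birkhoff (centered f) omega u + \sum_(i < size u) wmean f (omega i).
Proof.
rewrite -(@birkhoff_letter R m N) -birkhoffD; apply: eq_birkhoff => j a.
by rewrite /centered subrK.
Qed.

(** The correction per digit is the exponent of [sum_expR_centered], with [2 * fbound f] bounding
    the centred function. *)
Definition exp_mart f (t : R) omega u : \bar R :=
  (expR (t * birkhoff (centered f) omega u -
         2 * t ^+ 2 * (2 * fbound f) ^+ 2 * (size u)%:R))%:E.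

Lemma exp_mart_supermartingale f t omega : `|t| * (2 * fbound f) <= 2^-1 ->
  supermartingale w omega (exp_mart f t omega).
Proof.
move=> tF; split=> u; first by rewrite lee_fin expR_ge0.
under eq_bigr => a _.
  rewrite /exp_mart birkhoff_rcons inord_val size_rcons -EFinM.
  have -> : t * (birkhoff (centered f) omega u + centered f _ a) -
      2 * t ^+ 2 * (2 * fbound f) ^+ 2 * (size u).+1%:R =
      (t * birkhoff (centered f) omega u -
      2 * t ^+ 2 * (2 * fbound f) ^+ 2 * (size u)%:R) +
      (t * centered f _ a) - 2 * t ^+ 2 * (2 * fbound f) ^+ 2.
    by rewrite -natr1; ring.
  rewrite expRB expRD.
  have -> x y z : w (omega (size u)) a * (x * y / z) =
     x * z^-1 * (w (omega (size u)) a * y) by ring.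
  over.
rewrite sumEFin -mulr_sumr lee_fin -[leLHS]mulrA ler_piMr ?expR_ge0//.
rewrite ler_pdivrMl ?expR_gt0// mulr1.
by apply: sum_expR_centered => //; [exact: sum_centered|exact: centered_bound].
Qed.

(** For [l = 0] this is the largest parameter that [sum_expR_centered] admits. Dividing by [l.+1]
    makes the quadratic correction, once divided by the parameter, a drift of
    [2 * fbound f / l.+1%:R] per digit. *)
Let step f (l : nat) : R := (4 * fbound f * l.+1%:R)^-1.

Let step_gt0 f l : 0 < step f l.
Proof. by rewrite invr_gt0 !mulr_gt0// fbound_gt0. Qed.

Let step_le f l : `|step f l| * (2 * fbound f) <= 2^-1.
Proof.
have F0 := fbound_gt0 f.
rewrite gtr0_norm// /step invfM mulrAC -ler_pdivlMr ?invr_gt0// invrK.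
have -> : (4 * fbound f)^-1 * (2 * fbound f) = 2^-1.
  by field; rewrite gt_eqF.
by rewrite ler_peMr// ler1n.
Qed.

Let dev f l : R := (step f l)^-1 * ln (2 ^+ l.+4).

(** The parameters [step f l] and [- step f l] bound the two sides of the deviation; take logarithms
    and divide by the step. *)
Let exp_mart_dev f (l : nat) omega u :
  (exp_mart f (step f l) omega u <= (2 ^+ l.+4)%:E)%E ->
  (exp_mart f (- step f l) omega u <= (2 ^+ l.+4)%:E)%E ->
  `|birkhoff (centered f) omega u| <=
    2 * fbound f / l.+1%:R * (size u)%:R + dev f l.
Proof.
have p2 : 0 < 2 ^+ l.+4 :> R by rewrite exprn_gt0.
rewrite /exp_mart !lee_fin sqrrN -[in leRHS](lnK p2) ler_expR lerBlDr => h1.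
rewrite -[in leRHS](lnK p2) ler_expR lerBlDr mulNr lerNl => h2.
have s0 := step_gt0 f l; have F0 := fbound_gt0 f.
have e : 2 * fbound f / l.+1%:R * (size u)%:R + dev f l = (step f l)^-1 *
  (ln (2 ^+ l.+4) + 2 * step f l ^+ 2 * (2 * fbound f) ^+ 2 * (size u)%:R).
  have := ltr0Sn R l; rewrite /dev /step; move: (l.+1%:R) => x x0.
  by field; rewrite !gt_eqF.
by rewrite ler_norml e lerNl !ler_pdivlMl// mulrN lerNl h2.
Qed.

(** At each resolution [i] four exponential supermartingales start at 1. With coefficients
    [2 ^- i.+4] they start at 1/2 in total, and the cylinder masses add less than 1/2. Along a code
    that keeps the sum below 1, each of the four is at most [2 ^+ i.+4], which costs only a constant
    after taking logarithms. The predicate [b] selects the indices that really carry a cylinder. *)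
Lemma exists_good_code f1 f2 : exists C : R -> R,
  forall omega (b : pred nat) (c : nat -> seq nat),
  (\sum_(i <oo) (if b i then cyl_mass w omega (c i) [::] else 0)%:E < (2^-1)%:E)%E ->
  exists k, [/\ valid_code N omega k,
    forall delta n, 0 < delta ->
      `|birkhoff (centered f1) omega (mkseq k n)| <= delta * n%:R + C delta,
    forall delta n, 0 < delta ->
      `|birkhoff (centered f2) omega (mkseq k n)| <= delta * n%:R + C delta &
    forall i n, b i -> c i <> mkseq k n].
Proof.
(* The resolution at which the drift of both [f1] and [f2] falls below [delta]. *)
pose l delta := Num.truncn (2 * (fbound f1 + fbound f2) / delta).
have lP delta : 0 < delta -> 2 * (fbound f1 + fbound f2) / (l delta).+1%:R <= delta.
  move=> d0; rewrite ler_pdivrMr ?ltr0n// -ler_pdivrMl// [leLHS]mulrC.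
  by rewrite ltW// truncnS_gt.
exists (fun delta => Num.max (dev f1 (l delta)) (dev f2 (l delta))) => omega b c cov.
pose Z i u := ((2 ^- i.+4)%:E * ((exp_mart f1 (step f1 i) omega u +
   exp_mart f1 (- step f1 i) omega u) + (exp_mart f2 (step f2 i) omega u +
   exp_mart f2 (- step f2 i) omega u)))%E.
pose B i u := (if b i then cyl_mass w omega (c i) u else 0)%:E.
have B0 i u : (0 <= B i u)%E by rewrite lee_fin; case: ifP => // _; exact: cyl_mass_ge0.
have sZ i : supermartingale w omega (Z i).
  apply: supermartingaleZ => //.
  by apply: supermartingaleD => //; apply: supermartingaleD => //;
    apply: exp_mart_supermartingale; rewrite ?normrN.
have sB i : supermartingale w omega (B i).
  split=> // u; rewrite /B; case: ifP => _; last by rewrite big1// => ?; rewrite mule0.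
  by under eq_bigr do rewrite -EFinM; rewrite sumEFin lee_fin cyl_mass_rcons.
have sg : supermartingale w omega (fun u => \sum_(i <oo) (Z i u + B i u))%E.
  by apply: supermartingale_series => // i; exact: supermartingaleD.
have [k vk gk] := supermartingale_code w_ge0 w_sum sg.
have g0 : (\sum_(i <oo) (Z i [::] + B i [::]) < 1)%E.
  rewrite nneseriesD//; [|by move=> i _ _; exact: (sZ i).1].
  have Z0 : (\sum_(i <oo) Z i [::] <= (2^-1)%:E)%E.
    apply: le_trans (epsilon_trick0 xpredT (_ : 0 <= 2^-1)); last by [].
    apply: lee_nneseries => [i _ _|i _]; first exact: (sZ i).1.
    rewrite /Z /exp_mart /= !mulr0 subrr expR0 -!EFinD -EFinM lee_fin natrX.
    by rewrite !exprS; have := exprn_gt0 i (ltr0Sn R 1) => ?; rewrite le_eqVlt;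
      apply/orP; left; apply/eqP; field; rewrite gt_eqF.
  rewrite (_ : 1%E = (2^-1)%:E + (2^-1)%:E)%E; last by rewrite -EFinD; congr EFin; field.
  by apply: le_lt_trans (leeD2r _ Z0) _; rewrite lteD2lE.
have ZB i n : (Z i (mkseq k n) + B i (mkseq k n) < 1)%E.
  apply: (le_lt_trans _ (le_lt_trans (gk n) g0)).
  apply: (@le_trans _ _ (\sum_(0 <= j < i.+1) (Z j (mkseq k n) + B j (mkseq k n)))%E).
    by rewrite big_nat_recr//= leeDr// sume_ge0// => j _; rewrite adde_ge0// (sZ j).1.
  by apply: nneseries_lim_ge => j _ _; rewrite adde_ge0// (sZ j).1.
have ZB1 i n : (Z i (mkseq k n) <= 1)%E.
  by apply/ltW; apply: le_lt_trans (ZB i n); rewrite leeDl.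
have dv f delta n : fbound f <= fbound f1 + fbound f2 ->  0 < delta ->
  (exp_mart f (step f (l delta)) omega (mkseq k n) <= (2 ^+ (l delta).+4)%:E)%E ->
  (exp_mart f (- step f (l delta)) omega (mkseq k n) <= (2 ^+ (l delta).+4)%:E)%E ->
  `|birkhoff (centered f) omega (mkseq k n)| <= delta * n%:R + dev f (l delta).
  move=> F12 d0 /exp_mart_dev/[apply]; rewrite size_mkseq => /le_trans; apply.
  rewrite lerD2r ler_wpM2r// (le_trans _ (lP _ d0))//.
  by rewrite ler_wpM2r// ler_wpM2l.
have em0 f t u : (0 <= exp_mart f t omega u)%E by rewrite lee_fin expR_ge0.
have sum4 (x1 x2 x3 x4 M : \bar R) : (0 <= x1 -> 0 <= x2 -> 0 <= x3 -> 0 <= x4 ->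
    x1 + x2 + (x3 + x4) <= M -> [/\ x1 <= M, x2 <= M, x3 <= M & x4 <= M])%E.
  move=> h1 h2 h3 h4 h; have h12 : (0 <= x1 + x2)%E by rewrite adde_ge0.
  have h34 : (0 <= x3 + x4)%E by rewrite adde_ge0.
  split; apply: le_trans h.
  - by rewrite -addeA leeDl// adde_ge0.
  - by rewrite addeAC leeDr// adde_ge0.
  - by rewrite addeCA leeDl// adde_ge0.
  - by rewrite addeA leeDr// adde_ge0.
have ZB2 i n : [/\ exp_mart f1 (step f1 i) omega (mkseq k n) <= (2 ^+ i.+4)%:E,
    exp_mart f1 (- step f1 i) omega (mkseq k n) <= (2 ^+ i.+4)%:E,
    exp_mart f2 (step f2 i) omega (mkseq k n) <= (2 ^+ i.+4)%:E &
    exp_mart f2 (- step f2 i) omega (mkseq k n) <= (2 ^+ i.+4)%:E]%E.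
  by have := ZB1 i n; rewrite /Z lee_pdivrMl ?exprn_gt0// mule1; apply: sum4.
exists k; split => //.
- move=> delta n d0; apply: (le_trans (dv f1 _ _ _ d0 _ _)).
  + by rewrite lerDl ltW// fbound_gt0.
  + by case: (ZB2 (l delta) n).
  + by case: (ZB2 (l delta) n).
  + by rewrite lerD2l le_max lexx.
- move=> delta n d0; apply: (le_trans (dv f2 _ _ _ d0 _ _)).
  + by rewrite lerDr ltW// fbound_gt0.
  + by case: (ZB2 (l delta) n).
  + by case: (ZB2 (l delta) n).
  + by rewrite lerD2l le_max lexx orbT.
(* On the cylinder of [c i] itself the conditional mass is 1, against the strict bound by 1 on the
   whole sum. *)
move=> i n bi ci; have := ZB i n; rewrite /B bi -ci -[X in cyl_mass _ _ _ X]cats0.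
by rewrite cyl_mass_prefix ltNge leeDr// (sZ i).1.
Qed.

End good_codes.

(** * Pressure and the function beta *)

Lemma powR_exp (R : realType) (a x : R) : 0 < a -> a `^ x = expR (x * ln a).
Proof. by move=> a0; rewrite /powR gt_eqF. Qed.

(** Average the tangent line of the exponential at the weighted mean [c]. *)
Lemma jensen_expR (R : realType) (n : nat) (w h : 'I_n -> R) :
  (forall i, 0 <= w i) -> \sum_i w i = 1 ->
  expR (\sum_i w i * h i) <= \sum_i w i * expR (h i).
Proof.
move=> w0 w1; set c := \sum_i _ * h i.
have -> : expR c = \sum_i w i * (expR c * (1 + (h i - c))).
  under eq_bigr => i _.
    rewrite (_ : _ * _ = expR c * ((1 - c) * w i + w i * h i)); last by ring.
    over.
  by rewrite -mulr_sumr big_split/= -mulr_sumr w1 -/c mulr1 subrK mulr1.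
apply: ler_sum => i _; rewrite ler_wpM2l//.
by rewrite -{2}[h i](subrKC c) expRD ler_wpM2l ?expR_ge0// expR_ge1Dx.
Qed.

Section pressure.
Variables (R : realType) (m : nat) (theta : 'I_m.+1 -> R).
Hypothesis theta_gt0 : forall j, 0 < theta j.
Hypothesis theta_sum : \sum_j theta j = 1.
Variables (N : 'I_m.+1 -> nat) (lr lp : forall j, 'I_(N j).+1 -> R).
Arguments lr : clear implicits.
Arguments lp : clear implicits.
Hypothesis lr_lt0 : forall j k, lr j k < 0.

Definition potential (q b : R) j (k : 'I_(N j).+1) : R := q * lp j k + b * lr j k.

Definition partition_fun q b j : R := \sum_(k < (N j).+1) expR (potential q b k).

Definition gibbs q b j (k : 'I_(N j).+1) : R :=
  expR (potential q b k) / partition_fun q b j.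

Lemma partition_fun_gt0 q b j : 0 < partition_fun q b j.
Proof.
rewrite /partition_fun (bigD1 ord0)//= ltr_pwDl ?expR_gt0//.
by rewrite sumr_ge0// => k _; rewrite expR_ge0.
Qed.

Lemma gibbs_gt0 q b j (k : 'I_(N j).+1) : 0 < gibbs q b k.
Proof. by rewrite divr_gt0 ?expR_gt0// partition_fun_gt0. Qed.

Lemma gibbs_sum q b j : \sum_(k < (N j).+1) gibbs q b k = 1.
Proof. by rewrite -mulr_suml divff// gt_eqF// partition_fun_gt0. Qed.

Lemma ln_gibbs q b j (k : 'I_(N j).+1) :
  ln (gibbs q b k) = potential q b k - ln (partition_fun q b j).
Proof. by rewrite ln_div ?posrE ?expR_gt0 ?partition_fun_gt0// expRK. Qed.

Definition pressure q b : R := \sum_j theta j * ln (partition_fun q b j).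

(** For [lp] and [lr] these are the partial derivatives of the pressure in [q] and in [b]. *)
Definition gibbs_mean q b (f : forall j, 'I_(N j).+1 -> R) : R :=
  \sum_j theta j * \sum_(k < (N j).+1) gibbs q b k * f j k.

(** Letter by letter, Jensen's inequality under the Gibbs weights is applied to the increment of the
    potential: the Gibbs average of its exponential is the quotient of the two partition
    functions. *)
Lemma pressure_tangent q b q' b' :
  pressure q b + (q' - q) * gibbs_mean q b lp + (b' - b) * gibbs_mean q b lr
    <= pressure q' b'.
Proof.
rewrite /pressure /gibbs_mean !mulr_sumr -!big_split/=.
apply: ler_sum => j _.
have -> : theta j * ln (partition_fun q b j) +
   (q' - q) * (theta j * (\sum_(k < (N j).+1) gibbs q b k * lp j k)) +
   (b' - b) * (theta j * (\sum_(k < (N j).+1) gibbs q b k * lr j k)) =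
   theta j * (ln (partition_fun q b j) + \sum_(k < (N j).+1) gibbs q b k *
     (potential q' b' k - potential q b k)).
  under [in RHS]eq_bigr => k _.
    rewrite (_ : _ * _ = (q' - q) * (gibbs q b k * lp j k) +
      (b' - b) * (gibbs q b k * lr j k)); last by rewrite /potential; ring.
    over.
  by rewrite big_split/= -!mulr_sumr; ring.
rewrite ler_pM2l// -ler_expR expRD !lnK ?posrE ?partition_fun_gt0//.
rewrite -ler_pdivlMl ?partition_fun_gt0//.
apply: (le_trans (jensen_expR _ _ _)) => [k|//|]; first exact/ltW/gibbs_gt0.
  exact: gibbs_sum.
rewrite mulr_sumr ler_sum// => k _; rewrite /gibbs mulrAC mulrC.
by rewrite -expRD subrKC.
Qed.

Lemma gibbs_mean_lr_le : exists2 c, 0 < c & forall q b, gibbs_mean q b lr <= - c.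
Proof.
have [c c0 cP] := exists_neg_bound lr_lt0.
exists c => // q b.
rewrite -[leRHS]mul1r -theta_sum mulr_suml ler_sum// => j _.
rewrite ler_pM2l// -[leRHS]mul1r -(gibbs_sum q b j) mulr_suml ler_sum// => k _.
by rewrite ler_pM2l ?gibbs_gt0.
Qed.

Lemma gibbs_mean_bound f : exists C, forall q b, `|gibbs_mean q b f| <= C.
Proof.
exists (fbound f) => q b.
apply: (le_trans (ler_norm_sum _ _ _)).
rewrite -[leRHS]mul1r -theta_sum mulr_suml ler_sum// => j _.
rewrite normrM gtr0_norm// ler_pM2l//.
apply: (@le_wmean_fbound R m N (gibbs q b)) => [i k|i]; last exact: gibbs_sum.
exact/ltW/gibbs_gt0.
Qed.

Lemma gibbs_mean_cvg (T : Type) (F : set_system T) {FF : ProperFilter F}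
    (q b : T -> R) (q0 b0 : R) f :
  q t @[t --> F] --> q0 -> b t @[t --> F] --> b0 ->
  gibbs_mean (q t) (b t) f @[t --> F] --> gibbs_mean q0 b0 f.
Proof.
move=> qF bF.
have cE j (k : 'I_(N j).+1) : expR (potential (q t) (b t) k) @[t --> F] -->
    expR (potential q0 b0 k).
  apply: continuous_cvg; first exact: continuous_expR.
  by apply: cvgD; apply: cvgMr_tmp.
apply: cvg_big => [|j _]; first exact: add_continuous.
apply: cvgMl_tmp; apply: cvg_big => [|k _]; first exact: add_continuous.
apply: cvgMr_tmp; apply: cvgM; first exact: cE.
apply: cvgV; first by rewrite gt_eqF// partition_fun_gt0.
by apply: cvg_big => [|i _]; [exact: add_continuous|exact: cE].
Qed.

End pressure.

(** * Subgradients, derivative and tangents of beta *)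

Section beta.
Variables (R : realType) (m : nat) (theta : 'I_m.+1 -> R).
Hypothesis theta_gt0 : forall j, 0 < theta j.
Hypothesis theta_sum : \sum_j theta j = 1.
Variables (N : 'I_m.+1 -> nat) (lr lp : forall j, 'I_(N j).+1 -> R).
Arguments lr : clear implicits.
Arguments lp : clear implicits.
Hypothesis lr_lt0 : forall j k, lr j k < 0.
Variable beta : R -> R.
Hypothesis beta_root : forall q, pressure theta lr lp q (beta q) = 0.

(** The derivative that implicit differentiation of [pressure q (beta q) = 0] predicts. *)
Definition beta_slope q : R :=
  - (gibbs_mean theta lr lp q (beta q) lp / gibbs_mean theta lr lp q (beta q) lr).

Let mean_lr_lt0 q b : gibbs_mean theta lr lp q b lr < 0.
Proof.
have [c c0 cP] := gibbs_mean_lr_le theta_gt0 theta_sum lp lr_lt0.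
by rewrite (le_lt_trans (cP q b))// oppr_lt0.
Qed.

(** The pressure vanishes at both points, so the tangent inequality loses its constant terms;
    dividing by the negative mean of [lr] reverses it. *)
Lemma beta_subgradient q q' : beta q + beta_slope q * (q' - q) <= beta q'.
Proof.
have := pressure_tangent theta_gt0 lr lp q (beta q) q' (beta q').
rewrite !beta_root add0r /beta_slope.
have := mean_lr_lt0 q (beta q).
set A := gibbs_mean _ _ _ _ _ lp; set L := gibbs_mean _ _ _ _ _ lr => L0 h.
rewrite -lerBrDl mulNr mulrAC -mulNr ler_ndivrMr//.
by rewrite -subr_ge0; lra.
Qed.

Lemma beta_convex : @convex_function R R^o setT beta.
Proof.
move=> t x y _ _.
have t0 : 0 <= t%:num by [].
have t1 : 0 <= 1 - t%:num by rewrite subr_ge0.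
pose z : R := t%:num * x + (1 - t%:num) * y.
suff : beta z <= t%:num * beta x + (1 - t%:num) * beta y by [].
have := beta_subgradient z x; have := beta_subgradient z y.
move=> /(ler_wpM2l t1) h1 /(ler_wpM2l t0) h2.
apply: le_trans (lerD h2 h1).
rewrite le_eqVlt; apply/orP; left; apply/eqP.
by rewrite /z; ring.
Qed.

Let beta_slope_bound : exists2 C, 0 < C & forall q, `|beta_slope q| <= C.
Proof.
have [c c0 cP] := gibbs_mean_lr_le theta_gt0 theta_sum lp lr_lt0.
have [C CP] := gibbs_mean_bound theta_gt0 theta_sum lr lp lp.
have C0 : 0 <= C by apply: le_trans (CP 0 0).
exists (C / c + 1) => [|q]; first by rewrite ltr_pwDr// divr_ge0// ltW.
rewrite normrN normrM normfV ler_wpDr// ler_pM// lef_pV2 ?posrE//.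
  by rewrite ltr0_norm// lerNr.
by rewrite normr_gt0 lt_eqF.
Qed.

(** Only the defining equation of [beta] is given, so its continuity must be derived; it follows
    from bounded subgradients, the mean of [lr] being uniformly away from 0. *)
Lemma beta_lipschitz : exists2 C, 0 < C &
  forall q q', `|beta q - beta q'| <= C * `|q - q'|.
Proof.
have [C C0 CP] := beta_slope_bound; exists C => // q q'.
have sl z u : `|beta_slope z * u| <= C * `|u| by rewrite normrM ler_wpM2r.
have := beta_subgradient q q'; have := beta_subgradient q' q.
have := sl q (q' - q); have := sl q' (q - q').
rewrite [`|q' - q|]distrC !ler_norml => /andP[? ?] /andP[? ?] ? ?.
by apply/andP; split; lra.
Qed.

Lemma beta_cvg q : beta x @[x --> q] --> beta q.
Proof.
have [C C0 CP] := beta_lipschitz.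
apply/cvgrPdist_le => e e0; near=> x.
rewrite (le_trans (CP _ _))// -ler_pdivlMl//.
near: x; apply: (@cvgr_dist_le _ _ _ _ _ id q) => //.
by rewrite mulr_gt0// invr_gt0.
Unshelve. all: by end_near. Qed.

Lemma beta_slope_cvg q : beta_slope x @[x --> q] --> beta_slope q.
Proof.
apply: cvgN; apply: cvgM.
  exact: (gibbs_mean_cvg (F := nbhs q) (@cvg_id _ (nbhs q)) (@beta_cvg q)).
apply: cvgV; first by rewrite lt_eqF.
exact: (gibbs_mean_cvg (F := nbhs q) (@cvg_id _ (nbhs q)) (@beta_cvg q)).
Qed.

(** The subgradient inequalities at [q] and at [h + q] squeeze the difference quotient between the
    two slopes, and the slope is continuous. *)
Lemma beta_is_derive q : is_derive q (1 : R) beta (beta_slope q).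
Proof.
have h0 : h^-1 *: ((beta \o shift q) (h *: (1 : R)) - beta q) @[h --> 0^'] -->
    beta_slope q.
  have c1 : h + q @[h --> (0 : R)] --> q.
    rewrite -[X in _ --> X](add0r q).
    by apply: cvgD; [exact: cvg_id|exact: cvg_cst].
  have c2 : beta_slope (h + q) @[h --> (0 : R)] --> beta_slope q.
    apply: (cvg_comp _ beta_slope c1); exact: beta_slope_cvg.
  have sq : beta_slope (h + q) @[h --> 0^'] --> beta_slope q.
    by apply: cvg_trans c2; apply: cvg_app; exact: nbhs_dnbhs.
  apply/cvgrPdist_le => e e0.
  move/cvgrPdist_le : sq => /(_ e e0) sq.
  near=> h; have hn0 : h != 0 by near: h; exact: nbhs_dnbhs_neq.
  apply: (@le_trans _ _ `|beta_slope q - beta_slope (h + q)|); last by near: h.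
  rewrite /= -[h *: 1]/(h * 1) mulr1 -[h^-1 *: _]/(h^-1 * _).
  have h1 := beta_subgradient q (h + q); have h2 := beta_subgradient (h + q) q.
  have e1 : h + q - q = h by ring. have e2 : q - (h + q) = - h by ring.
  rewrite e1 in h1; rewrite e2 in h2.
  set s := beta_slope q in h1 *; set s' := beta_slope (h + q) in h2 *.
  set D := _ - beta q.
  have D1 : s * h <= D by rewrite /D; lra.
  have D2 : D <= s' * h by rewrite /D; lra.
  have [hp|hp|h0] := ltgtP 0 h; last by rewrite -h0 eqxx in hn0.
    have L1 : s <= h^-1 * D by rewrite ler_pdivlMl// mulrC.
    have L2 : h^-1 * D <= s' by rewrite ler_pdivrMl// mulrC.
    by rewrite !ler0_norm; lra.
  have L1 : h^-1 * D <= s by rewrite ler_ndivrMl// mulrC.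
  have L2 : s' <= h^-1 * D by rewrite ler_ndivlMl// mulrC.
  by rewrite !ger0_norm; lra.
apply: DeriveDef; first by apply/cvg_ex; exists (beta_slope q).
exact/cvg_lim.
Unshelve. all: by end_near. Qed.

Lemma derive1_beta q : beta^`()%classic q = beta_slope q.
Proof. by rewrite derive1E; have dB := beta_is_derive q; rewrite derive_val. Qed.

Definition tuple_mean (f : forall j, 'I_(N j).+1 -> R)
  (k : {dffun forall j : 'I_m.+1, 'I_(N j).+1}) : R := \sum_j theta j * f j (k j).

Definition tuple_ratio k := tuple_mean lp k / tuple_mean lr k.

Lemma tuple_mean_lr_lt0 k : tuple_mean lr k < 0.
Proof.
rewrite /tuple_mean -oppr_gt0 -sumrN (bigD1 ord0)//= ltr_pwDl//.
  by rewrite oppr_gt0 pmulr_rlt0.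
by rewrite sumr_ge0// => j _; rewrite oppr_ge0 pmulr_rle0// ltW.
Qed.

(** Keeping only the term [k j] of each partition function bounds the pressure below by a linear
    function of [q] and [beta q]. *)
Lemma beta_ge_ratio q k : - q * tuple_ratio k <= beta q.
Proof.
have : pressure theta lr lp q (beta q) >=
    q * tuple_mean lp k + beta q * tuple_mean lr k.
  rewrite /tuple_mean !mulr_sumr -big_split; apply: ler_sum => j _ /=.
  rewrite mulrCA [beta q * _]mulrCA -mulrDr ler_pM2l// -ler_expR lnK; last first.
    by rewrite posrE partition_fun_gt0.
  rewrite /partition_fun (bigD1 (k j))//= [leRHS]addrC -[leLHS]add0r lerD//.
  by rewrite sumr_ge0// => i _; exact: expR_ge0.
rewrite beta_root /tuple_ratio mulrA => h.
by rewrite ler_ndivrMr ?tuple_mean_lr_lt0//; lra.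
Qed.

Lemma exists_tangent alpha k1 k2 : tuple_ratio k1 < alpha < tuple_ratio k2 ->
  exists q, [/\ alpha = - beta_slope q,
    forall q', beta q + alpha * q <= beta q' + alpha * q' &
    0 <= beta q + alpha * q].
Proof.
move=> /andP[k1a ak2].
(* The line of [k1] gives coercivity for [q >= 0], that of [k2] for [q < 0]. *)
pose kappa := Num.min (alpha - tuple_ratio k1) (tuple_ratio k2 - alpha).
have kappa0 : 0 < kappa by rewrite lt_min !subr_gt0 k1a.
have coer q : kappa * `|q| <= beta q + alpha * q.
  have k1' : kappa <= alpha - tuple_ratio k1 by rewrite ge_min lexx.
  have k2' : kappa <= tuple_ratio k2 - alpha by rewrite ge_min lexx orbT.
  have b1 := beta_ge_ratio q k1; have b2 := beta_ge_ratio q k2.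
  have [q0|q0] := ger0P q.
    by rewrite (le_trans (ler_wpM2r q0 k1'))//; lra.
  have q1 : 0 <= - q by lra.
  by rewrite (le_trans (ler_wpM2r q1 k2'))//; lra.
(* Outside [[- M, M]] coercivity puts [f] above [beta 0], which is [f 0], so a minimum over this
   interval is global. *)
pose M := `|beta 0| / kappa + 1.
have M0 : 0 < M by rewrite ltr_wpDl// divr_ge0// ltW.
pose f q := beta q + alpha * q.
have fder q : is_derive q (1 : R) f (beta_slope q + alpha).
  have db := beta_is_derive q.
  have da : is_derive q (1 : R) (alpha *: (@id R)) (alpha *: 1).
    by apply: is_deriveZ.
  have := is_deriveD db da.
  by rewrite -[alpha *: 1]/(alpha * 1) mulr1.
have [c cM cmin] : exists2 c, c \in `[- M, M] & forall t, t \in `[- M, M] -> f c <= f t.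
  apply: EVT_min; first by lra.
  apply: continuous_subspaceT => q.
  by apply: cvgD; [exact: beta_cvg|exact: cvgMl_tmp].
have glob t : f c <= f t.
  have [tM|tM] := boolP (t \in `[- M, M]); first exact: cmin.
  have f0 : f c <= f 0 by apply: cmin; rewrite in_itv /=; lra.
  apply: (le_trans f0); rewrite {1}/f mulr0 addr0.
  apply: (le_trans (ler_norm _)); apply: le_trans (coer t).
  rewrite -ler_pdivrMl//.
  move: tM; rewrite in_itv /= -ler_norml -ltNge /M => /ltW.
  by apply: le_trans; rewrite mulrC lerDl.
(* As [c] is a global minimiser, any open interval around it will do, even when [c] is an endpoint
   of [[- M, M]]. *)
have dc : is_derive c (1 : R) f 0.
  apply: (@derive1_at_min _ f (c - 1) (c + 1)) => //; first by lra.
  by rewrite in_itv /=; lra.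
have e0 : beta_slope c + alpha = 0.
  by have [_ <-] := fder c; have [_ <-] := dc.
exists c; split; [|exact: glob|].
  by apply/eqP; rewrite -addr_eq0 addrC e0.
by apply: le_trans (coer c); rewrite mulr_ge0// ltW.
Qed.

End beta.

(** * Letter frequencies of almost every word *)

(** Letter frequencies equal to theta, tested against every function of a letter, so that it applies
    directly to logarithms of partition functions and to conditional means. *)
Definition good_word (R : realType) (m : nat) (theta : 'I_m.+1 -> R)
    (omega : nat -> 'I_m.+1) : Prop :=
  forall (h : 'I_m.+1 -> R) delta, 0 < delta -> exists C, forall n,
    `|\sum_(i < n) h (omega i) - n%:R * \sum_j theta j * h j| <= delta * n%:R + C.

Section bernoulli.
Variables (R : realType) (m : nat) (theta : 'I_m.+1 -> R).
Hypothesis theta_gt0 : forall j, 0 < theta j.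
Hypothesis theta_sum : \sum_j theta j = 1.
Variable P : probability (words m) R.
Hypothesis P_bernoulli : is_bernoulli theta P.

Fixpoint letter_words n : seq (seq 'I_m.+1) :=
  if n is n'.+1 then [seq a :: v | a <- enum 'I_m.+1, v <- letter_words n']
  else [:: [::]].

Lemma mem_letter_words u : u \in letter_words (size u).
Proof.
elim: u => [//|a u IH] /=; apply/allpairsPdep.
by exists a, u; rewrite mem_enum.
Qed.

Lemma sum_letter_words (g : 'I_m.+1 -> R) n :
  \sum_(u <- letter_words n) \prod_(j <- u) g j = (\sum_j g j) ^+ n.
Proof.
elim: n => [|n IH]; first by rewrite /= big_cons !big_nil addr0 expr0.
rewrite /= big_allpairs_dep exprS.
under eq_bigr do under eq_bigr do rewrite big_cons.
under eq_bigr do rewrite -mulr_sumr IH.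
by rewrite -mulr_suml big_enum.
Qed.

Lemma measurable_cylinder (u : seq 'I_m.+1) :
  measurable (cylinder u : set (words m)).
Proof. by apply: sub_gen_smallest; exists u. Qed.

Lemma measure_bigsetU_cylinder (s : seq (seq 'I_m.+1)) (Q : pred (seq 'I_m.+1)) :
  (P (\big[setU/set0]_(u <- s | Q u) cylinder u) <=
   \sum_(u <- s | Q u) P (cylinder u))%E.
Proof.
elim: s => [|u s IH]; first by rewrite !big_nil measure0.
rewrite !big_cons; case: ifP => // _.
apply: (le_trans (measureU2 _ _ _)).
- exact: measurable_cylinder.
- by apply: bigsetU_measurable => v _; exact: measurable_cylinder.
- exact: leeD2l.
Qed.

Definition deviation (x : 'I_m.+1 -> R) delta n : set (words m) :=
  [set omega : nat -> 'I_m.+1 | delta * n%:R <= \sum_(i < n) x (omega i)].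

(** The event depends on the first [n] letters only. This finite union of cylinders gives both its
    measurability and a bound by cylinder probabilities. *)
Lemma deviationE x delta n : deviation x delta n =
  \big[setU/set0]_(u <- letter_words n | delta * n%:R <= \sum_(j <- u) x j)
    cylinder u.
Proof.
have sumE (omega : nat -> 'I_m.+1) :
    \sum_(i < n) x (omega i) = \sum_(j <- mkseq omega n) x j.
  elim: n => [|k IH]; first by rewrite big_ord0 big_nil.
  by rewrite big_ord_recr mkseqS -cats1 big_cat big_seq1 IH.
have szW u : u \in letter_words n -> size u = n.
  elim: (n) u => [|k IH] u /=; first by rewrite inE => /eqP ->.
  by move=> /allpairsPdep[a [v [_ /IH <- ->]]].
apply/seteqP; split => omega; rewrite /deviation /= sumE.
  move=> h; rewrite -big_filter -bigcup_seq; exists (mkseq omega n).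
    rewrite /= mem_filter h /=.
    by have := mem_letter_words (mkseq omega n); rewrite size_mkseq.
  by rewrite /cylinder /= size_mkseq.
rewrite -big_filter -bigcup_seq => -[u /=].
rewrite mem_filter => /andP[h /szW un].
by rewrite /cylinder /= un => ->.
Qed.

Lemma measurable_deviation x delta n : measurable (deviation x delta n).
Proof.
rewrite deviationE; apply: bigsetU_measurable => u _.
exact: measurable_cylinder.
Qed.

Lemma chernoff x delta n : \sum_j theta j * x j = 0 -> (forall j, `|x j| <= 1) ->
  0 < delta <= 1 ->
  (P (deviation x delta n) <= (expR (- (delta ^+ 2 / 8)) ^+ n)%:E)%E.
Proof.
move=> x0 x1 /andP[d0 d1]; rewrite deviationE.
apply: (le_trans (measure_bigsetU_cylinder _ _)).
under eq_bigr do rewrite P_bernoulli.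
rewrite sumEFin lee_fin.
(* Minimises the exponent [2 * t ^+ 2 - t * delta], with value [- (delta ^+ 2 / 8)]. The next step
   is Markov's inequality, with the indicator of a deviation bounded by an exponential. *)
pose t := delta / 4.
apply: (@le_trans _ _ (\sum_(u <- letter_words n)
  expR (- (t * (delta * n%:R))) * \prod_(j <- u) (theta j * expR (t * x j)))).
  rewrite [leLHS]big_mkcond /=; apply: ler_sum => u _.
  rewrite big_split/= -expR_sum -mulr_sumr.
  have p0 : 0 <= \prod_(j <- u) theta j by apply: prodr_ge0 => j _; exact: ltW.
  case: ifP => h; last by rewrite !mulr_ge0// expR_ge0.
  rewrite mulrCA -expRD ler_peMr// -[leLHS]expR0 ler_expR.
  by rewrite addrC -mulrBr mulr_ge0 ?subr_ge0// divr_ge0// ltW.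
rewrite -mulr_sumr sum_letter_words.
have h : \sum_j theta j * expR (t * x j) <= expR (2 * t ^+ 2 * 1 ^+ 2).
  apply: sum_expR_centered => // [j|]; first exact: ltW.
  by rewrite mulr1 /t ger0_norm ?divr_ge0 ?(ltW d0)//; lra.
have -> : t * (delta * n%:R) = (t * delta) * n%:R by rewrite mulrA.
rewrite -mulNr expRM_natr -exprMn lerXn2r ?nnegrE ?expR_ge0//.
  rewrite mulr_ge0 ?expR_ge0// sumr_ge0// => j _.
  by rewrite mulr_ge0 ?expR_ge0 ?ltW.
apply: (le_trans (ler_wpM2l (expR_ge0 _) h)); rewrite -expRD ler_expR /t.
by rewrite le_eqVlt; apply/orP; left; apply/eqP; field.
Qed.

Lemma ae_deviation x delta : \sum_j theta j * x j = 0 -> (forall j, `|x j| <= 1) ->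
  0 < delta <= 1 ->
  {ae P, forall omega : words m, exists C, forall n,
    \sum_(i < n) x (omega i) <= delta * n%:R + C}.
Proof.
move=> x0 x1 d01; have /andP[d0 d1] := d01.
exists (lim_sup_set (deviation x delta)); split.
- apply: bigcapT_measurable => n; apply: bigcup_measurable => k _.
  exact: measurable_deviation.
- apply: lim_sup_set_cvg0 => [n|]; first exact: measurable_deviation.
  set a := expR (- (delta ^+ 2 / 8)).
  have a0 : 0 < a by exact: expR_gt0.
  have a1 : a < 1 by rewrite expR_lt1 oppr_lt0 divr_gt0// exprn_gt0.
  apply: (@le_lt_trans _ _ (\sum_(n <oo) (a ^+ n)%:E)%E).
    by apply: lee_nneseries => // n _; exact: chernoff.
  apply: (@le_lt_trans _ _ (1 / (1 - a))%:E); last exact: ltry.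
  apply: lime_le; first by apply: is_cvg_nneseries => n _ _; rewrite lee_fin exprn_ge0// ltW.
  apply: nearW => n; rewrite sumEFin lee_fin.
  have := @geometric_le_lim R n 1 a ler01 a0.
  rewrite gtr0_norm// => /(_ a1); rewrite /series /=.
  by under eq_bigr do rewrite mul1r.
- move=> omega /= h; apply: contrapT => hn; apply: h.
  have : ~ (forall n, exists2 k, (n <= k)%N & deviation x delta k omega).
    move=> hk; apply: hn => n _; have [k nk hk'] := hk n.
    by exists k.
  (* No deviation occurs from index [n] on; at earlier indices the sum is at most its number of
     terms, so [n%:R] is a valid constant. *)
  move=> /existsNP[n /forall2NP hk]; exists n%:R => k.
  have [kn|nk] := leqP k n; last first.
    have [|/negP] := hk k; first by rewrite (ltnW nk).
    by rewrite -ltNge => /ltW/le_trans; apply; rewrite lerDl.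
  rewrite (le_trans (ler_norm _))// (le_trans (ler_norm_sum _ _ _))//.
  apply: (@le_trans _ _ (\sum_(i < k) 1)); first by apply: ler_sum => i _.
  rewrite sumr_const card_ord ler_wpDl ?ler_nat//.
  by rewrite mulr_ge0// ltW.
Qed.

(** Null sets may be collected only countably often: the deviation bound is used for centred
    indicators of letters and for [delta] of the form [l.+1%:R^-1], and a general [h] is a linear
    combination of indicators. *)
Lemma ae_good_word : {ae P, forall omega : words m, good_word theta omega}.
Proof.
pose x j (i : 'I_m.+1) : R := (i == j)%:R - theta j.
have x0 j : \sum_i theta i * x j i = 0.
  rewrite /x; under eq_bigr do rewrite mulrBr.
  rewrite sumrB -mulr_suml theta_sum mul1r (bigD1 j)//= eqxx mulr1 big1 ?addr0 ?subrr//.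
  by move=> i /negbTE ->; rewrite mulr0.
have t1 j : theta j <= 1.
  rewrite -theta_sum (bigD1 j)//= lerDl sumr_ge0// => i _; exact: ltW.
have x1 j i : `|x j i| <= 1.
  have := theta_gt0 j; have := t1 j.
  by rewrite /x ler_norml; case: (i == j) => /= ? ?; apply/andP; split; lra.
(* Letters are indexed by naturals through [inord], to fit a countable intersection of almost sure
   events. *)
have ae1 : {ae P, forall omega : words m, forall l j : nat,
    (exists C, forall n, \sum_(i < n) x (inord j) (omega i) <=
       l.+1%:R^-1 * n%:R + C) /\
    (exists C, forall n, \sum_(i < n) (- x (inord j) (omega i)) <=
       l.+1%:R^-1 * n%:R + C)}.
  apply: ae_foralln => l; apply: ae_foralln => j.
  have l1 : 0 < (l.+1%:R^-1 : R) <= 1.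
    by rewrite invr_gt0 ltr0n /= invf_le1 ?ltr0n// ler1n.
  apply: filterS2 (ae_deviation (x0 (inord j)) (x1 (inord j)) l1)
    (ae_deviation (x := fun i => - x (inord j) i) _ _ l1) => //.
  - by under eq_bigr do rewrite mulrN; rewrite sumrN x0 oppr0.
  - by move=> i; rewrite normrN.
apply: filterS ae1 => omega hom h delta d0.
pose H := \sum_j `|h j| + 1.
have H0 : 0 < H by rewrite ltr_wpDl// sumr_ge0.
pose l := Num.truncn (H / delta).
have lP : l.+1%:R^-1 <= delta / H.
  by rewrite -[leRHS]invf_div lef_pV2 ?posrE ?ltr0n ?divr_gt0// ltW// truncnS_gt.
have hj j : exists C, forall n, `|\sum_(i < n) x j (omega i)| <= delta / H * n%:R + C.
  have [[C1 h1] [C2 h2]] := hom l j; rewrite !inord_val in h1 h2.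
  exists (Num.max C1 C2) => n; rewrite ler_norml lerNl -sumrN.
  by apply/andP; split; [apply: (le_trans (h2 n))|apply: (le_trans (h1 n))];
    rewrite lerD ?ler_wpM2r// le_max lexx ?orbT.
have [C CP] := choice hj.
exists (\sum_j `|h j| * `|C j|) => n.
have -> : \sum_(i < n) h (omega i) - n%:R * (\sum_j theta j * h j) =
    \sum_j h j * \sum_(i < n) x j (omega i).
  under [RHS]eq_bigr do rewrite mulr_sumr.
  rewrite exchange_big/=.
  have e i : \sum_j h j * x j (omega i) = h (omega i) - \sum_j theta j * h j.
    rewrite /x; under eq_bigr do rewrite mulrBr [h _ * theta _]mulrC.
    rewrite sumrB (bigD1 (omega i))//= eqxx mulr1 big1 ?addr0// => j.
    by rewrite eq_sym => /negbTE ->; rewrite mulr0.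
  under [RHS]eq_bigr do rewrite e.
  by rewrite sumrB sumr_const card_ord mulr_natl.
apply: (le_trans (ler_norm_sum _ _ _)).
apply: (@le_trans _ _ (\sum_j (`|h j| * (delta / H * n%:R) + `|h j| * `|C j|))).
  apply: ler_sum => j _; rewrite normrM -mulrDr ler_wpM2l//.
  by rewrite (le_trans (CP j n))// lerD2l ler_norm.
rewrite big_split/= lerD2r -mulr_suml mulrA ler_wpM2r// mulrCA ler_piMr ?(ltW d0)//.
by rewrite ler_pdivrMr// mul1r lerDl.
Qed.

End bernoulli.

(** * Coding of the random attractors *)

Section enorm.
Variables (R : realType) (d : nat).
Implicit Types (x y : 'rV[R]_d) (A : set 'rV[R]_d).

Lemma enorm_ge0 x : 0 <= enorm x.
Proof. exact: sqrtr_ge0. Qed.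

Lemma enorm_sqr x : enorm x ^+ 2 = \sum_(i < d) x ord0 i ^+ 2.
Proof. by rewrite sqr_sqrtr// sumr_ge0// => i _; rewrite sqr_ge0. Qed.

Lemma enorm0 : enorm (0 : 'rV[R]_d) = 0.
Proof. by rewrite /enorm big1 ?sqrtr0// => i _; rewrite mxE expr0n. Qed.

Lemma enorm_distC x y : enorm (x - y) = enorm (y - x).
Proof.
by rewrite /enorm; congr Num.sqrt; apply: eq_bigr => i _; rewrite !mxE -sqrrN opprB.
Qed.

Lemma normr_le_enorm x : `|x| <= enorm x.
Proof.
rewrite [leLHS]/Num.Def.normr /= mx_normrE; apply: bigmax_le; first exact: enorm_ge0.
move=> -[i j] _ /=; rewrite (ord1 i) -sqrtr_sqr ler_wsqrtr// (bigD1 j)//= lerDl.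
by rewrite sumr_ge0// => k _; rewrite sqr_ge0.
Qed.

Lemma coord_le_normr x j : `|x ord0 j| <= `|x|.
Proof.
rewrite [leRHS]/Num.Def.normr /= mx_normrE.
exact: (le_bigmax _ (fun ij : 'I_1 * 'I_d => `|x ij.1 ij.2|) (ord0, j)).
Qed.

Lemma enorm_le_normr x : enorm x <= Num.sqrt d%:R * `|x|.
Proof.
rewrite -[X in _ * X]ger0_norm// -sqrtr_sqr -sqrtrM// ler_wsqrtr//.
rewrite -[d in d%:R]card_ord -sum1_card natr_sum mulr_suml ler_sum// => i _.
by rewrite mul1r -[leLHS]real_normK ?num_real// lerXn2r ?nnegrE// coord_le_normr.
Qed.

Lemma closed_cball x e : closed (cball x e).
Proof.
have [e0|e0] := ltP e 0.
  rewrite (_ : cball x e = set0); first exact: closed0.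
  apply/seteqP; split => // y /=; rewrite /cball /= => h.
  by have := le_lt_trans h e0; rewrite ltNge enorm_ge0.
have enE y : enorm (y - x) ^+ 2 = \sum_(i < d) (y ord0 i - x ord0 i) ^+ 2.
  by rewrite enorm_sqr; apply: eq_bigr => i _; rewrite !mxE.
have -> : cball x e =
    (fun y : 'rV[R]_d => \sum_(i < d) (y ord0 i - x ord0 i) ^+ 2) @^-1`
      [set t | t <= e ^+ 2].
  apply/seteqP; split => y /=; rewrite /cball /= -(ler_sqr (enorm_ge0 _))//;
    by rewrite enE.
apply: preimage_closed; last exact: closed_le.
move=> y _; pose f i (z : 'rV[R]_d) : R := (z ord0 i - x ord0 i) ^+ 2.
have cf i : {for y, continuous (f i)}.
  have cB : {for y, continuous (fun z : 'rV[R]_d => z ord0 i - x ord0 i)}.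
    by apply: continuousB; [exact: coord_continuous|exact: cst_continuous].
  exact: (continuous_comp cB (@exprn_continuous R 2 _)).
have cs (s : seq 'I_d) : {for y, continuous (fun z => \sum_(i <- s) f i z)}.
  elim: s => [|i s IH].
    rewrite (_ : (fun _ => _) = cst 0); first exact: cst_continuous.
    by apply/funext => z; rewrite big_nil.
  rewrite (_ : (fun _ => _) = (fun z => f i z + \sum_(i <- s) f i z)).
    exact: continuousD.
  by apply/funext => z; rewrite big_cons.
exact: cs.
Qed.

Lemma closureP_enorm A x :
  (forall e, 0 < e -> exists2 y, A y & enorm (x - y) <= e) -> closure A x.
Proof.
move=> h B /nbhs_ballP[e /= e0 eB].
have [y Ay xy] := h (e / 2) (divr_gt0 e0 (ltr0Sn _ _)).
exists y; split=> //; apply: eB; rewrite -ball_normE /ball_ /=.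
by rewrite (le_lt_trans (normr_le_enorm _))// (le_lt_trans xy)//; lra.
Qed.

Lemma compact_enorm_bounded A : compact A ->
  exists2 D, 0 < D & forall x y, A x -> A y -> enorm (x - y) <= D.
Proof.
move=> /compact_bounded[M [Mr AM]].
have AM1 x : A x -> `|x| <= `|M| + 1.
  by apply: AM; rewrite (le_lt_trans (ler_norm _))// ltrDl.
exists (Num.sqrt d%:R * ((`|M| + 1) + (`|M| + 1)) + 1).
  by rewrite ltr_wpDl// mulr_ge0// addr_ge0// addr_ge0.
move=> x y /AM1 xM /AM1 yM; rewrite (le_trans (enorm_le_normr _))// ler_wpDr//.
by rewrite ler_wpM2l ?sqrtr_ge0// (le_trans (ler_normB _ _))// lerD.
Qed.

Lemma hausdorff_dist_lt A B e : A !=set0 -> B !=set0 -> compact A -> compact B ->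
  hausdorff_dist A B < e ->
  (forall x, A x -> exists2 y, B y & enorm (x - y) <= e) /\
  (forall y, B y -> exists2 x, A x & enorm (x - y) <= e).
Proof.
move=> [a Aa] [b Bb] cA cB; rewrite /hausdorff_dist => /inf_lt h.
have cAB : compact (A `|` B) by exact: compactU.
have [D D0 DP] := compact_enorm_bounded cAB.
have [|t [t0 tA tB] te] := h.
  (* The infimum only says something once its set is inhabited; a bound on all distances within the
     union belongs to it. *)
  exists D; split; first exact: ltW.
    by move=> x Ax; exists b => //; apply: DP; [left|right].
  by move=> y By; exists a => //; apply: DP; [left|right].
split=> [x /tA[y By xy]|y /tB[x Ax xy]].
  by exists y => //; exact: le_trans (ltW te).
by exists x => //; exact: le_trans (ltW te).
Qed.

Lemma similitude_continuous r (f : 'rV[R]_d -> 'rV[R]_d) :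
  similitude r f -> continuous f.
Proof.
move=> sf x B /nbhs_ballP[e /= e0 eB].
pose c := `|r| * Num.sqrt d%:R + 1.
have c0 : 0 < c by rewrite ltr_wpDl// mulr_ge0// sqrtr_ge0.
apply/nbhs_ballP; exists (e / c) => /=; first exact: divr_gt0.
move=> y; rewrite -ball_normE /ball_ /= => xy; apply: eB.
rewrite -ball_normE /ball_ /= (le_lt_trans (normr_le_enorm _))// sf.
apply: (@le_lt_trans _ _ (c * `|x - y|)); last by rewrite mulrC -ltr_pdivlMr.
apply: (@le_trans _ _ (`|r| * (Num.sqrt d%:R * `|x - y|))).
  apply: (@le_trans _ _ (`|r| * enorm (x - y))).
    by rewrite ler_wpM2r ?enorm_ge0// ler_norm.
  by rewrite ler_wpM2l// enorm_le_normr.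
by rewrite mulrA ler_wpM2r// lerDl.
Qed.

Lemma closed_borel (A : set (borelRd R d)) : closed (A : set 'rV[R]_d) -> measurable A.
Proof.
move=> cA; rewrite -(setCK A); apply: measurableC.
by apply: sub_gen_smallest; exact: closed_openC.
Qed.

End enorm.

(** * Cylinders, approximants and the coding of points *)

Section coding.
Variables (R : realType) (d m : nat) (N : 'I_m.+1 -> nat).
Variables (Sm : forall j, 'I_(N j).+1 -> 'rV[R]_d -> 'rV[R]_d).
Variables (r : forall j, 'I_(N j).+1 -> R).
Arguments Sm : clear implicits.
Arguments r : clear implicits.
Hypothesis r_bounds : forall j k, 0 < r j k < 1.
Hypothesis Sm_sim : forall j k, similitude (r j k) (Sm j k).
Variables (K0 : set 'rV[R]_d) (eps : R).
Hypothesis K0_inv : invariant_compact Sm K0.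
Hypothesis eps_gt0 : 0 < eps.
Hypothesis K0_sep : forall j (k1 k2 : 'I_(N j).+1), k1 != k2 ->
  forall x y, K0 x -> K0 y -> eps <= enorm (Sm j k1 x - Sm j k2 y).
Variable K : (nat -> 'I_m.+1) -> set 'rV[R]_d.
Hypothesis K_attr : is_random_attractor Sm K.

Definition log_of (f : forall j, 'I_(N j).+1 -> R) j k : R := ln (f j k).
Arguments log_of : clear implicits.

Fixpoint word_map (omega : nat -> 'I_m.+1) (u : seq nat) (x : 'rV[R]_d) :=
  if u is a :: v then Sm (omega 0%N) (inord a) (word_map (Defs.shift omega) v x)
  else x.

Definition word_ratio omega u : R := expR (birkhoff (log_of r) omega u).

Lemma word_ratio_gt0 omega u : 0 < word_ratio omega u.
Proof. exact: expR_gt0. Qed.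

Lemma log_of_lt0 j k : log_of r j k < 0.
Proof. by rewrite /log_of ln_lt0// r_bounds. Qed.

Lemma word_ratio_le1 omega u : word_ratio omega u <= 1.
Proof.
rewrite -expR0 ler_expR; elim: u omega => //= a u IH omega.
by rewrite -[leRHS]addr0 lerD// ltW// log_of_lt0.
Qed.

Lemma word_ratio_cons omega a u : word_ratio omega (a :: u) =
  r (omega 0%N) (inord a) * word_ratio (Defs.shift omega) u.
Proof.
rewrite /word_ratio /= expRD /log_of lnK// posrE.
by have /andP[] := r_bounds (inord a : 'I_(N (omega 0%N)).+1).
Qed.

Lemma word_map_ratio omega u x y :
  enorm (word_map omega u x - word_map omega u y) =
  word_ratio omega u * enorm (x - y).
Proof.
elim: u omega => [|a u IH] omega; first by rewrite /word_ratio /= expR0 mul1r.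
by rewrite word_ratio_cons /= Sm_sim IH mulrA.
Qed.

Lemma Sm_K0 j k x : K0 x -> K0 (Sm j k x).
Proof. by have [_ _ h] := K0_inv => Kx; apply: (h j k); exists x. Qed.

Lemma word_map_K0 omega u x : K0 x -> K0 (word_map omega u x).
Proof. by move=> Kx; elim: u omega => [|a u IH] omega //=; apply: Sm_K0. Qed.

(** At the first digit where the words differ, uniform separation gives distance [eps]. The common
    prefix scales it by its own ratio, which is at least that of [u]: the parent of the word sets
    the scale, not the word itself. *)
Lemma word_separation omega u a v x y : size v = (size u).+1 ->
  valid_word N omega (rcons u a) -> valid_word N omega v -> v != rcons u a ->
  K0 x -> K0 y ->
  eps * word_ratio omega u <=
    enorm (word_map omega (rcons u a) x - word_map omega v y).
Proof.
have sep (om : nat -> 'I_m.+1) b c x' y' : (b <= N (om 0%N))%N ->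
    (c <= N (om 0%N))%N -> c != b -> K0 x' -> K0 y' ->
    eps <= enorm (Sm (om 0%N) (inord b) x' - Sm (om 0%N) (inord c) y').
  move=> bN cN cb Kx Ky; apply: K0_sep => //.
  apply: contra cb => /eqP /(congr1 val) /=.
  by rewrite !inordK ?ltnS// => ->.
move=> + + + + Kx Ky; elim: u omega v => [|c u IH] omega [|b v]//= [suv].
  move=> /andP[aN _] /andP[bN _]; case: v suv => //= _ ba.
  rewrite /word_ratio expR0 mulr1; apply: sep => //.
  by apply: contra ba => /eqP ->.
move=> /andP[cN uN] /andP[bN vN]; rewrite eqseq_cons negb_and.
have [->|bc _] /= := eqVneq b c.
  move=> vu; rewrite word_ratio_cons Sm_sim mulrCA.
  have /andP[/ltW r0 _] := r_bounds (inord c : 'I_(N (omega 0%N)).+1).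
  by apply: ler_wpM2l => //; exact: IH.
apply: le_trans (sep _ _ _ _ _ _ _ bc _ _) => //; last 2 first.
- exact: word_map_K0.
- exact: word_map_K0.
by rewrite ler_piMr ?(ltW eps_gt0)// word_ratio_le1.
Qed.

Definition approximant omega n : set 'rV[R]_d :=
  foldr (ifs_image Sm) K0 (mkseq omega n).

Lemma approximantS omega n : approximant omega n.+1 =
  ifs_image Sm (omega 0%N) (approximant (Defs.shift omega) n).
Proof. by rewrite /approximant mkseq_head. Qed.

Lemma approximantP omega n x : approximant omega n x <->
  exists u, [/\ size u = n, valid_word N omega u &
    exists2 y, K0 y & x = word_map omega u y].
Proof.
split.
  elim: n omega x => [|n IH] omega x.
    by move=> Kx; exists [::]; split => //; exists x.
  rewrite approximantS => -[k _ [y /IH[u [un uN [z Kz ->]]] <-]].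
  exists (val k :: u); split => /=; first by rewrite un.
    by rewrite -ltnS ltn_ord.
  by exists z => //; rewrite inord_val.
move=> [u [<- uN [y Ky ->]]] {n x}; elim: u omega uN => [//|a u IH] omega.
move=> /= /andP[aN uN]; rewrite approximantS; exists (inord a) => //.
by exists (word_map (Defs.shift omega) u y) => //; exact: IH.
Qed.

Lemma word_map_take omega n u y : word_map omega u y =
  word_map omega (take n u) (word_map (fun i => omega (i + n)%N) (drop n u) y).
Proof.
elim: n u omega => [|n IH] u omega.
  rewrite take0 drop0 /=; congr word_map.
  by apply/funext => i; rewrite addn0.
case: u => //= a u; rewrite IH; congr (Sm _ _ (word_map _ _ (word_map _ _ _))).
by apply/funext => i; rewrite /Defs.shift addnS.
Qed.

Lemma valid_word_take omega n u : valid_word N omega u ->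
  valid_word N omega (take n u).
Proof.
by elim: u n omega => [|a u IH] [|n] omega //= /andP[-> uN] /=; exact: IH.
Qed.

Lemma word_unique omega u v x y : size u = size v ->
  valid_word N omega u -> valid_word N omega v -> K0 x -> K0 y ->
  word_map omega u x = word_map omega v y -> u = v.
Proof.
case/lastP: u => [|u a]; first by case: v.
rewrite size_rcons => /esym suv uN vN Kx Ky uv.
apply/esym/eqP; apply: contraT => vu.
have := word_separation suv uN vN vu Kx Ky.
by rewrite uv subrr enorm0 leNgt mulr_gt0// word_ratio_gt0.
Qed.

Lemma approximant_sub omega n k : (n <= k)%N ->
  approximant omega k `<=` approximant omega n.
Proof.
move=> nk x /approximantP[u [uk uN [y Ky ->]]]; apply/approximantP.
exists (take n u); rewrite size_takel ?uk//; split => //.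
  elim: u n omega {uk nk} uN => [|a u IH] [|n] omega //= /andP[-> uN] /=.
  exact: IH.
exists (word_map (fun i => omega (i + n)%N) (drop n u) y).
  exact: word_map_K0.
exact: word_map_take.
Qed.

Lemma closed_approximant omega n : closed (approximant omega n) /\
  approximant omega n `<=` K0.
Proof.
have [K0n K0c _] := K0_inv.
have hK : hausdorff_space 'rV[R]_d by exact: norm_hausdorff.
elim: n omega => [|n IH] omega; first by split => //; exact: compact_closed.
have [c s] := IH (Defs.shift omega); rewrite approximantS; split.
  apply: closed_bigcup => [|k _]; first exact: finite_finset.
  apply: compact_closed => //; apply: continuous_compact.
    exact/continuous_subspaceT/(similitude_continuous (Sm_sim _)).
  exact: subclosed_compact K0c _.
by move=> x [k _ [y /s Ky <-]]; exact: Sm_K0.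
Qed.

Lemma compact_approximant omega n : compact (approximant omega n).
Proof.
have [K0n K0c _] := K0_inv; have [c s] := closed_approximant omega n.
exact: subclosed_compact K0c _.
Qed.

Lemma approximant_nonempty omega n : approximant omega n !=set0.
Proof.
have [[x Kx] _ _] := K0_inv; exists (word_map omega (nseq n 0%N) x).
apply/approximantP; exists (nseq n 0%N); rewrite size_nseq; split => //; last by exists x.
by elim: n omega => //=.
Qed.

Lemma approximant_close omega e : 0 < e -> forall n, exists2 k, (n <= k)%N &
  hausdorff_dist (approximant omega k) (K omega) < e.
Proof.
move=> e0 n; have [_ _ h] := K_attr omega; have [K0n K0c _] := K0_inv.
have /cvgrPdist_lt/(_ e e0)[M _ MP] := h K0 K0n K0c.
exists (maxn n M); first exact: leq_maxl.
have := MP (maxn n M) (leq_maxr _ _); rewrite sub0r normrN => /(le_lt_trans _).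
by apply; exact: ler_norm.
Qed.

(** The approximants of [K0] are compact and decreasing, so their Hausdorff limit is their
    intersection; closedness turns approximation at arbitrarily late levels into membership. *)
Lemma attractorE omega x : K omega x <-> forall n, approximant omega n x.
Proof.
have [Kn Kc _] := K_attr omega; split => [Kx n|h].
  apply: (closed_approximant omega n).1; apply: closureP_enorm => e e0.
  have [k nk hk] := approximant_close omega e0 n.
  have [_ /(_ x Kx)[y Ty yx]] := hausdorff_dist_lt (approximant_nonempty omega k) Kn
    (@compact_approximant omega k) Kc hk.
  by exists y; [exact: approximant_sub nk _ Ty|rewrite enorm_distC].
apply: (compact_closed (@norm_hausdorff _ _) Kc); apply: closureP_enorm => e e0.
have [k _ hk] := approximant_close omega e0 0.
have [/(_ x (h k))[y Ky xy] _] := hausdorff_dist_lt (approximant_nonempty omega k) Kn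
    (@compact_approximant omega k) Kc hk.
by exists y.
Qed.

(** The coding map as a relation: [x] lies in every cylinder set along [k], and no limit has to be
    taken. *)
Definition codes omega k x := forall n, exists2 y, K0 y & x = word_map omega (mkseq k n) y.

Lemma codes_attractor omega k x : valid_code N omega k -> codes omega k x -> K omega x.
Proof.
move=> vk ck; apply/attractorE => n; apply/approximantP.
exists (mkseq k n); rewrite size_mkseq; split => //; exact: valid_mkseq.
Qed.

(** Follow one base point along the prefixes of [k] and take a cluster point; each cylinder set is
    closed and contains a tail of the sequence. *)
Lemma exists_point omega k : valid_code N omega k -> exists x, codes omega k x.
Proof.
move=> vk; have [[z Kz] K0c _] := K0_inv.
have hK : hausdorff_space 'rV[R]_d by exact: norm_hausdorff.
pose s n := word_map omega (mkseq k n) z.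
have [x [Kx clx]] : K0 `&` cluster (s @ \oo) !=set0.
  by apply: K0c; exists 0%N => // n _; exact: word_map_K0.
pose C n := [set word_map omega (mkseq k n) y | y in K0].
have cC n : closed (C n).
  apply: compact_closed => //; apply: continuous_compact => //.
  apply: continuous_subspaceT; elim: (mkseq k n) (omega) => [|a u IH] om /=.
    by move=> ?; exact: cvg_id.
  move=> y; apply: continuous_comp; first exact: IH.
  exact: (similitude_continuous (Sm_sim _)).
exists x => n; suff [y Ky <-] : C n x by exists y.
apply: cC => B Bx.
have sC : (s @ \oo) (C n).
  exists n => // j /= nj; rewrite /s.
  rewrite (word_map_take _ n) {1}/mkseq -map_take take_iota (minn_idPl nj).
  by eexists; [|reflexivity]; exact: word_map_K0.
have [y [Cy By]] := clx _ _ sC Bx.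
by exists y.
Qed.

(** Choose a word of each length whose cylinder contains [x]. Separation makes it unique, so each
    word is a prefix of the next, and the last digits form the code. *)
Lemma exists_code omega x : K omega x -> exists2 k, valid_code N omega k & codes omega k x.
Proof.
move=> /attractorE h.
have /choice[W WP] n : exists u, [/\ size u = n, valid_word N omega u &
    exists2 y, K0 y & x = word_map omega u y] by apply/approximantP.
have Wt n : take n (W n.+1) = W n.
  have [sW vW [y Ky xy]] := WP n; have [sW1 vW1 [z Kz xz]] := WP n.+1.
  rewrite (word_map_take _ n) xy in xz; apply: esym.
  apply: (word_unique _ vW _ Ky _ xz).
  - by rewrite sW size_takel// sW1.
  - exact: valid_word_take.
  - exact: word_map_K0.
pose k n := nth 0%N (W n.+1) n.
have kW n : mkseq k n = W n.
  elim: n => [|n IH]; first by have [/size0nil -> _ _] := WP 0%N.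
  have [sW1 _ _] := WP n.+1.
  by rewrite mkseqS IH -Wt -take_nth ?sW1// -[in RHS](take_size (W n.+1)) sW1.
exists k => [n|n]; last by rewrite kW; have [_ _] := WP n.
have [sW1 + _] := WP n.+1; rewrite -kW mkseqS valid_word_rcons size_mkseq.
by move=> /andP[].
Qed.

End coding.

(** * Masses of cylinders and balls *)

Section masses.
Variables (R : realType) (d m : nat) (N : 'I_m.+1 -> nat).
Variables (Sm : forall j, 'I_(N j).+1 -> 'rV[R]_d -> 'rV[R]_d).
Variables (r p : forall j, 'I_(N j).+1 -> R).
Arguments Sm : clear implicits.
Arguments r : clear implicits.
Arguments p : clear implicits.
Hypothesis r_bounds : forall j k, 0 < r j k < 1.
Hypothesis Sm_sim : forall j k, similitude (r j k) (Sm j k).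
Hypothesis p_gt0 : forall j k, 0 < p j k.
Hypothesis p_sum : forall j, \sum_k p j k = 1.
Variables (K0 : set 'rV[R]_d) (eps : R).
Hypothesis K0_inv : invariant_compact Sm K0.
Hypothesis eps_gt0 : 0 < eps.
Hypothesis K0_sep : forall j (k1 k2 : 'I_(N j).+1), k1 != k2 ->
  forall x y, K0 x -> K0 y -> eps <= enorm (Sm j k1 x - Sm j k2 y).
Variable K : (nat -> 'I_m.+1) -> set 'rV[R]_d.
Hypothesis K_attr : is_random_attractor Sm K.
Variable mu : (nat -> 'I_m.+1) -> probability (borelRd R d) R.
Hypothesis mu_self : is_random_measure Sm p K mu.

Definition word_mass omega u : R := expR (birkhoff (log_of p) omega u).

Lemma word_mass_gt0 omega u : 0 < word_mass omega u.
Proof. exact: expR_gt0. Qed.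

Lemma word_mass_cons omega a u : word_mass omega (a :: u) =
  p (omega 0%N) (inord a) * word_mass (Defs.shift omega) u.
Proof. by rewrite /word_mass /= expRD /log_of lnK// posrE. Qed.

Lemma preimage_closed_Sm j k (E : set 'rV[R]_d) : closed E -> closed (Sm j k @^-1` E).
Proof.
move: E; apply/continuous_closedP; exact: (similitude_continuous (Sm_sim _)).
Qed.

Let measurableC_K omega : measurable (~` K omega : set (borelRd R d)).
Proof.
have [_ cK _] := K_attr omega; apply: measurableC; apply: closed_borel.
by apply: compact_closed => //; exact: norm_hausdorff.
Qed.

Let attractor_sub omega : K omega `<=` K0.
Proof. by move=> x /(attractorE Sm_sim K0_inv K_attr)/(_ 0%N). Qed.

Let mu_disjoint omega (E : set (borelRd R d)) : closed (E : set 'rV[R]_d) ->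
  (forall x, K omega x -> ~ E x) -> mu omega E = 0%E.
Proof.
move=> cE KE; apply/eqP; rewrite eq_le measure_ge0 andbT -(mu_self.1 omega).
apply: le_measure; rewrite ?inE//; first exact: closed_borel.
by move=> x Ex Kx; exact: KE Kx Ex.
Qed.

(** Induction along the self-similarity, keeping only the summand of the first digit. Closedness
    passes to preimages under similitudes, so measurability survives the induction. *)
Lemma word_mass_le_measure omega u (E : set (borelRd R d)) :
  closed (E : set 'rV[R]_d) -> valid_word N omega u ->
  (forall y, K0 y -> E (word_map Sm omega u y)) ->
  ((word_mass omega u)%:E <= mu omega E)%E.
Proof.
elim: u omega E => [|a u IH] omega E cE.
  move=> _ KE; rewrite /word_mass /= expR0.
  have mE : measurable E by exact: closed_borel.
  have := probability_setC (mu omega) mE.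
  have -> : mu omega (~` E) = 0%E.
    apply/eqP; rewrite eq_le measure_ge0 andbT -(mu_self.1 omega).
    apply: le_measure; rewrite ?inE//; first exact: measurableC.
    by move=> x Ex Kx; apply/Ex/KE/attractor_sub/Kx.
  by move=> /esym/eqP; rewrite sube_eq ?add0e ?ge0_adde_def ?inE// => /eqP <-.
move=> /= /andP[aN uN] KE; rewrite mu_self.2; last exact: closed_borel.
rewrite (bigD1 (inord a))//= word_mass_cons EFinM.
rewrite -[leLHS]adde0 leeD//.
  apply: lee_wpmul2l; first by rewrite lee_fin ltW.
  by apply: IH => //; exact: preimage_closed_Sm.
by rewrite sume_ge0// => k _; rewrite mule_ge0// lee_fin ltW.
Qed.

(** The summands with another first digit vanish, because the preimage of [E] misses the attractor
    of the shifted word. *)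
Lemma measure_le_word_mass omega u (E : set (borelRd R d)) :
  closed (E : set 'rV[R]_d) -> valid_word N omega u ->
  (forall v, size v = size u -> valid_word N omega v -> v != u ->
    forall y, K0 y -> ~ E (word_map Sm omega v y)) ->
  (mu omega E <= (word_mass omega u)%:E)%E.
Proof.
elim: u omega E => [|a u IH] omega E cE.
  move=> _ KE; rewrite /word_mass /= expR0.
  by rewrite probability_le1//; exact: closed_borel.
move=> /= /andP[aN uN] KE; rewrite mu_self.2; last exact: closed_borel.
rewrite (bigD1 (inord a))//= word_mass_cons EFinM big1 ?adde0.
  apply: lee_wpmul2l; first by rewrite lee_fin ltW.
  apply: IH => //; first exact: preimage_closed_Sm.
  move=> v vu vN vnu y Ky; apply: (KE (a :: v)) => //=; first by rewrite vu.
    by rewrite aN.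
  by rewrite eqseq_cons eqxx.
move=> k ka; rewrite mu_disjoint ?mule0//; first exact: preimage_closed_Sm.
move=> x /(attractorE Sm_sim K0_inv K_attr)/(_ (size u))/approximantP.
move=> [v [vu vN [y Ky ->]]] /=.
have := KE (val k :: v); rewrite /= inord_val; apply => //.
- by rewrite vu.
- by rewrite vN andbT -ltnS ltn_ord.
- rewrite eqseq_cons negb_and; apply/orP; left; apply: contra ka => /eqP <-.
  by rewrite inord_val.
Qed.

Lemma cball_mass_ge omega k x D n e : (forall y z, K0 y -> K0 z -> enorm (y - z) <= D) ->
  valid_code N omega k -> codes Sm K0 omega k x ->
  D * word_ratio r omega (mkseq k n) <= e ->
  ((word_mass omega (mkseq k n))%:E <= mu omega (cball x e))%E.
Proof.
move=> KD vk ck De; apply: word_mass_le_measure.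
- exact: closed_cball.
- exact: valid_mkseq.
move=> y Ky; have [z Kz xz] := ck n; rewrite /cball /= {1}xz.
rewrite (word_map_ratio r_bounds Sm_sim) (le_trans _ De)// mulrC ler_wpM2r ?KD//.
exact/ltW/word_ratio_gt0.
Qed.

(** Below [eps] times the ratio of level [n], a ball meets no other cylinder of level [n.+1]; hence
    the shift of index between hypothesis and bound. *)
Lemma cball_mass_le omega k x n e :
  valid_code N omega k -> codes Sm K0 omega k x ->
  e < eps * word_ratio r omega (mkseq k n) ->
  (mu omega (cball x e) <= (word_mass omega (mkseq k n.+1))%:E)%E.
Proof.
move=> vk ck De; apply: measure_le_word_mass.
- exact: closed_cball.
- exact: valid_mkseq.
move=> v sv vN vk' y Ky; rewrite /cball /= => h.
have [z Kz xz] := ck n.+1.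
have := valid_mkseq n.+1 vk; rewrite mkseqS => vr.
have sv' : size v = (size (mkseq k n)).+1 by rewrite sv !size_mkseq.
rewrite mkseqS in vk' xz.
have := word_separation r_bounds Sm_sim K0_inv eps_gt0 K0_sep sv' vr vN vk' Kz Ky.
rewrite leNgt => /negP; apply.
by rewrite -xz enorm_distC (le_lt_trans h).
Qed.

End masses.

(** * Local dimensions *)

Section birkhoff_growth.
Variables (R : realType) (m : nat) (N : 'I_m.+1 -> nat).
Implicit Types (f : forall j, 'I_(N j).+1 -> R).

Lemma birkhoff_step_le f omega k n s C : (forall j a, f j a <= C) ->
  birkhoff f omega (mkseq k (n + s)) <= birkhoff f omega (mkseq k n) + C * s%:R.
Proof.
move=> fC; elim: s => [|s IH]; first by rewrite addn0 mulr0 addr0.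
rewrite addnS mkseqS birkhoff_rcons size_mkseq -[in leRHS]natr1 mulrDr mulr1.
by rewrite addrA lerD.
Qed.

Lemma birkhoff_step_ge f omega k n s C : (forall j a, C <= f j a) ->
  birkhoff f omega (mkseq k n) + C * s%:R <= birkhoff f omega (mkseq k (n + s)).
Proof.
move=> fC; elim: s => [|s IH]; first by rewrite addn0 mulr0 addr0.
rewrite addnS mkseqS birkhoff_rcons size_mkseq -[in leLHS]natr1 mulrDr mulr1.
by rewrite addrA lerD.
Qed.

End birkhoff_growth.

Lemma ratio_perturb (R : realType) (A A' B B' C1 C2 c : R) : B < 0 -> B' < 0 ->
  `|A - A'| <= C1 -> `|B - B'| <= C2 -> `|A' / B'| <= c ->
  `|A / B - A' / B'| <= (C1 + c * C2) / `|B|.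
Proof.
move=> B0 B'0 hA hB hc.
have -> : A / B - A' / B' = ((A - A') - (A' / B') * (B - B')) / B.
  by field; rewrite !lt_eqF.
rewrite normrM normfV ler_wpM2r ?invr_ge0// (le_trans (ler_normB _ _))// lerD//.
by rewrite normrM ler_pM.
Qed.

Section local_dimension.
Variables (R : realType) (d m : nat) (N : 'I_m.+1 -> nat).
Variables (Sm : forall j, 'I_(N j).+1 -> 'rV[R]_d -> 'rV[R]_d).
Variables (r p : forall j, 'I_(N j).+1 -> R).
Arguments Sm : clear implicits.
Arguments r : clear implicits.
Arguments p : clear implicits.
Hypothesis r_bounds : forall j k, 0 < r j k < 1.
Hypothesis Sm_sim : forall j k, similitude (r j k) (Sm j k).
Hypothesis p_gt0 : forall j k, 0 < p j k.
Hypothesis p_sum : forall j, \sum_k p j k = 1.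
Variables (K0 : set 'rV[R]_d) (eps : R).
Hypothesis K0_inv : invariant_compact Sm K0.
Hypothesis eps_gt0 : 0 < eps.
Hypothesis K0_sep : forall j (k1 k2 : 'I_(N j).+1), k1 != k2 ->
  forall x y, K0 x -> K0 y -> eps <= enorm (Sm j k1 x - Sm j k2 y).
Variable K : (nat -> 'I_m.+1) -> set 'rV[R]_d.
Hypothesis K_attr : is_random_attractor Sm K.
Variable mu : (nat -> 'I_m.+1) -> probability (borelRd R d) R.
Hypothesis mu_self : is_random_measure Sm p K mu.

Let lr := log_of r.
Let lp := log_of p.
Arguments lr : clear implicits.
Arguments lp : clear implicits.

Definition symbolic_dim omega k n : R :=
  birkhoff lp omega (mkseq k n) / birkhoff lr omega (mkseq k n).

Lemma exists_lr_bound : exists2 c, 0 < c & forall j k, lr j k <= - c.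
Proof.
have [c c0 cP] := exists_neg_bound (log_of_lt0 r_bounds).
by exists c => // j k; exact: cP.
Qed.

Lemma birkhoff_lr_le : exists2 c, 0 < c &
  forall omega k n, birkhoff lr omega (mkseq k n) <= - (c * n%:R).
Proof.
have [c c0 cP] := exists_lr_bound; exists c => // omega k n.
have := @birkhoff_step_le _ _ _ lr omega k 0 n (- c) cP.
by rewrite add0n add0r mulNr.
Qed.

Lemma symbolic_dim_bound : exists C, forall omega k n, `|symbolic_dim omega k n| <= C.
Proof.
have [c c0 cP] := birkhoff_lr_le.
exists (fbound lp / c) => omega k [|n].
  by rewrite /symbolic_dim /= mul0r normr0 divr_ge0 ?ltW// fbound_gt0.
have F0 := fbound_gt0 lp.
have h1 : `|birkhoff lp omega (mkseq k n.+1)| <= fbound lp * n.+1%:R.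
  rewrite birkhoff_mkseq (le_trans (ler_norm_sum _ _ _))//.
  rewrite -[n.+1 in leRHS]card_ord -sum1_card natr_sum mulr_sumr ler_sum// => i _.
  by rewrite mulr1 le_fbound.
have h2 := cP omega k n.+1.
have cn : 0 < c * n.+1%:R by rewrite mulr_gt0.
have b0 : birkhoff lr omega (mkseq k n.+1) < 0 by rewrite (le_lt_trans h2)// oppr_lt0.
rewrite /symbolic_dim normrM normfV ler_pdivrMr ?normr_gt0 ?lt_eqF//.
rewrite (le_trans h1)// mulrAC -mulrA ler_pM2l//.
rewrite ler_pdivlMr// ltr0_norm// mulrC lerNr. exact: h2.
Qed.

(** The radius determines the first level [n] with [D * Rn n <= e]. The logarithms of mass and
    radius then differ from the Birkhoff sums at level [n] by bounded amounts, while [ln e] tends to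
    minus infinity. *)
Lemma log_quotient_approx omega k x : valid_code N omega k ->
  codes Sm K0 omega k x -> forall delta M, 0 < delta ->
  exists2 e0, 0 < e0 & forall e, 0 < e < e0 -> exists n q,
    [/\ (M <= n)%N, log_quotient (mu omega) x e = q%:E &
        `|q - symbolic_dim omega k n| <= delta].
Proof.
move=> vk ck delta M delta0.
have [K0n K0c _] := K0_inv.
have [D0 D00 KD0] := compact_enorm_bounded K0c.
pose D := D0 + 1.
have D1 : 1 <= D by rewrite lerDr ltW.
have D_gt0 : 0 < D by exact: lt_le_trans D1.
have KD y z : K0 y -> K0 z -> enorm (y - z) <= D.
  by move=> Ky Kz; rewrite (le_trans (KD0 _ _ Ky Kz))// lerDl.
have [c c0 cP] := exists_lr_bound.
have [c1 c10 c1P] := birkhoff_lr_le.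
have [C0 C0P] := symbolic_dim_bound.
have C00 : 0 <= C0 by apply: le_trans (C0P omega k 0%N).
pose Rn n := word_ratio r omega (mkseq k n).
(* Going back [s] more levels bridges the gap between the diameter bound [D] and the separation
   [eps]. *)
have [s /(_ s (leqnn s)) sP] := expR_decay_le D_gt0 eps_gt0 c0.
pose Fp := fbound lp; pose Fr := fbound lr.
have Fp0 : 0 < Fp by exact: fbound_gt0.
have Fr0 : 0 < Fr by exact: fbound_gt0.
have lnD : 0 <= ln D by exact: ln_ge0.
(* The total error that [ratio_perturb] charges for numerator and denominator. *)
pose C1 := Fp * s.+1%:R + C0 * (ln D + Fr).
have C10 : 0 <= C1.
  have := ltW Fp0; have := ltW Fr0 => Fr0' Fp0'.
  by rewrite addr_ge0// mulr_ge0// addr_ge0.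
pose M' := (maxn M s).+1.
(* The three thresholds make [ln e] negative, force [n] above both [M] and [s], and push the error
   [C1] over the absolute value of [ln e] below [delta]. *)
exists (Num.min 1 (Num.min (D * Rn M') (expR (- (C1 / delta))))).
  by rewrite !lt_min ltr01 expR_gt0 mulr_gt0// word_ratio_gt0.
move=> e /andP[e0]; rewrite !lt_min => /and3P[e1 eM eC].
have ex_n : exists n, D * Rn n <= e.
  have [n /(_ n (leqnn n)) nP] := expR_decay_le D_gt0 e0 c10.
  exists n; apply: le_trans nP; rewrite ler_pM2l// ler_expR; exact: c1P.
pose n := ex_minn ex_n.
have [nP nmin] : D * Rn n <= e /\ (forall i, D * Rn i <= e -> (n <= i)%N).
  by rewrite /n; case: ex_minnP.
have nM : (M' < n)%N.
  rewrite ltnNge; apply/negP => nM.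
  have : Rn M' <= Rn n.
    rewrite ler_expR -(subnKC nM).
    have := @birkhoff_step_le _ _ _ lr omega k n (M' - n) 0.
    by rewrite mul0r addr0; apply => j a; rewrite ltW// log_of_lt0.
  by rewrite leNgt -(ltr_pM2l D_gt0) (le_lt_trans nP).
have [n' nE] : exists n', n = (n' + s).+1.
  exists (n.-1 - s)%N; rewrite subnK; first by rewrite prednK// (leq_ltn_trans _ nM).
  rewrite -ltnS prednK; last by rewrite (leq_ltn_trans _ nM).
  by rewrite (leq_trans _ nM)// ltnS (leq_trans (leq_maxr M s)).
have eR : e < D * Rn (n' + s)%N.
  rewrite ltNge; apply/negP => /nmin; rewrite nE ltnNge leqnn//.
have eR' : e < eps * Rn n'.
  apply: (lt_le_trans eR); apply: (@le_trans _ _ (D * (expR (- (c * s%:R)) * Rn n'))).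
    rewrite ler_pM2l// -expRD ler_expR addrC -mulNr.
    exact: birkhoff_step_le.
  by rewrite mulrA ler_wpM2r// ltW// word_ratio_gt0.
pose P i := word_mass p omega (mkseq k i).
have PP i : 0 < P i by exact: word_mass_gt0.
have mge : ((P n)%:E <= mu omega (cball x e))%E.
  exact: (cball_mass_ge r_bounds Sm_sim p_gt0 K0_inv K_attr mu_self KD).
have mle : (mu omega (cball x e) <= (P n'.+1)%:E)%E.
  exact: (cball_mass_le r_bounds Sm_sim p_gt0 K0_inv eps_gt0 K0_sep K_attr mu_self).
have [v vE] : exists v, mu omega (cball x e) = v%:E.
  by exists (fine (mu omega (cball x e))); rewrite fineK// fin_num_measure//;
    apply: (@closed_borel R d (cball x e)); exact: closed_cball.
rewrite vE !lee_fin in mge mle.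
have v0 : 0 < v by exact: lt_le_trans mge.
exists n, (ln v / ln e); split.
- by rewrite (leq_trans _ (ltnW nM))// /M' (leq_trans (leq_maxl M s)).
- by rewrite /log_quotient vE lne_EFin.
have lne0 : ln e < 0 by rewrite ln_lt0// e0.
have cn : birkhoff lr omega (mkseq k n) < 0.
  apply: le_lt_trans (c1P _ _ _) _; rewrite oppr_lt0 mulr_gt0// ltr0n.
  exact: leq_ltn_trans nM.
have h1 : `|ln v - birkhoff lp omega (mkseq k n)| <= Fp * s.+1%:R.
  rewrite ger0_norm; last first.
    by rewrite subr_ge0 -ler_expR lnK.
  rewrite lerBlDl.
  apply: (@le_trans _ _ (birkhoff lp omega (mkseq k n'.+1))).
    by rewrite -ler_expR lnK.
  have lpF j a : - Fp <= lp j a by have := le_fbound lp a; rewrite ler_norml => /andP[].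
  have := birkhoff_step_ge omega k n'.+1 s lpF; rewrite addSn -nE mulNr lerBlDr.
  move=> /le_trans; apply; rewrite lerD2l ler_pM2l// ler_nat//.
have h2 : `|ln e - birkhoff lr omega (mkseq k n)| <= ln D + Fr.
  rewrite ler_norml; apply/andP; split.
    rewrite lerBrDl -ler_expR [in leRHS]lnK// (le_trans _ nP)//.
    rewrite -[D in leRHS](lnK D_gt0) -expRD ler_expR addrC lerD2r.
    by rewrite opprD; lra.
  rewrite lerBlDl -ler_expR lnK// (le_trans (ltW eR))//.
  rewrite -[D in leLHS](lnK D_gt0) -expRD ler_expR addrCA lerD2l.
  have lrF j a : - Fr <= lr j a by have := le_fbound lr a; rewrite ler_norml => /andP[].
  have := birkhoff_step_ge omega k (n' + s) 1 lrF.
  by rewrite mulr1 addn1 -nE lerBlDr.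
apply: (le_trans (ratio_perturb lne0 cn h1 h2 (C0P omega k n))).
rewrite ltr0_norm// ler_pdivrMr ?oppr_gt0// -ler_pdivrMl// [leLHS]mulrC -/C1.
by rewrite lerNr -ler_expR lnK// ltW.
Qed.

End local_dimension.

(** * Upper and lower limits along a filter *)

Section limf.
Variables (T : choiceType) (X : filteredType T) (R : realType).
Variables (f : X -> \bar R) (F : set_system X).
Context {FF : ProperFilter F}.
Local Open Scope ereal_scope.

Lemma limf_esup_le c : (\forall x \near F, f x <= c) -> limf_esup f F <= c.
Proof.
move=> fc; rewrite limf_esupE; apply: ge_ereal_inf.
exists (ereal_sup (f @` [set x | f x <= c])); first by eexists; [exact: fc|].
by apply: ge_ereal_sup => _ [x /= xc <-].
Qed.

Lemma limf_esup_ge c : (\forall x \near F, c <= f x) -> c <= limf_esup f F.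
Proof.
move=> fc; rewrite limf_esupE; apply: le_ereal_inf_tmp => _ [V FV <-].
have [x [Vx cx]] := filter_ex (filterI FV fc).
by apply: le_ereal_sup_tmp; exists (f x) => //; exists x.
Qed.

(** The upper bound holds on some [W] in the filter, and the supremum over [V] intersected with [W]
    still exceeds [a - delta]. *)
Lemma limf_esup_frequently (a delta : R) : limf_esup f F = a%:E -> (0 < delta)%R ->
  forall V, F V -> exists2 x, V x & (a - delta)%:E < f x < (a + delta)%:E.
Proof.
move=> fa d0 V FV.
have [W FW Wlt] : exists2 W, F W & forall x, W x -> f x < (a + delta)%:E.
  have : limf_esup f F < (a + delta)%:E by rewrite fa lte_fin ltrDl.
  rewrite limf_esupE => /ereal_inf_lt[_ [W FW <-] Wlt]; exists W => // x Wx.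
  by apply: le_lt_trans Wlt; apply: ereal_sup_ubound; exists x.
have : (a - delta)%:E < ereal_sup (f @` (V `&` W)).
  apply: (@lt_le_trans _ _ (limf_esup f F)); first by rewrite fa lte_fin gtrBl.
  by rewrite limf_esupE; apply: ereal_inf_lbound; exists (V `&` W) => //; exact: filterI.
by move=> /ereal_sup_gt[_ [x [Vx Wx] <-] lt]; exists x => //; rewrite lt Wlt.
Qed.

End limf.

Section limf_inf.
Variables (T : choiceType) (X : filteredType T) (R : realType).
Variables (f : X -> \bar R) (F : set_system X).
Context {FF : ProperFilter F}.
Local Open Scope ereal_scope.

Lemma limf_einf_le c : (\forall x \near F, f x <= c) -> limf_einf f F <= c.
Proof.
move=> fc; rewrite /limf_einf leeNl; apply: limf_esup_ge.
by apply: filterS fc => x; rewrite leeN2.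
Qed.

Lemma limf_einf_ge c : (\forall x \near F, c <= f x) -> c <= limf_einf f F.
Proof.
move=> fc; rewrite /limf_einf leeNr; apply: limf_esup_le.
by apply: filterS fc => x; rewrite leeN2.
Qed.

Lemma limf_einf_frequently (a delta : R) : limf_einf f F = a%:E -> (0 < delta)%R ->
  forall V, F V -> exists2 x, V x & (a - delta)%:E < f x < (a + delta)%:E.
Proof.
move=> fa d0 V FV.
have fa' : limf_esup (\- f) F = (- a)%:E by rewrite limf_esupN fa.
have [x Vx /andP[]] := limf_esup_frequently fa' d0 FV.
rewrite lteNr lteNl -!EFinN !opprD !opprK => h1 h2.
by exists x => //; rewrite h1 h2.
Qed.

End limf_inf.

Section dimension_transfer.
Variables (R : realType) (d m : nat) (N : 'I_m.+1 -> nat).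
Variables (Sm : forall j, 'I_(N j).+1 -> 'rV[R]_d -> 'rV[R]_d).
Variables (r p : forall j, 'I_(N j).+1 -> R).
Arguments Sm : clear implicits.
Arguments r : clear implicits.
Arguments p : clear implicits.
Hypothesis r_bounds : forall j k, 0 < r j k < 1.
Hypothesis Sm_sim : forall j k, similitude (r j k) (Sm j k).
Hypothesis p_gt0 : forall j k, 0 < p j k.
Hypothesis p_sum : forall j, \sum_k p j k = 1.
Variables (K0 : set 'rV[R]_d) (eps : R).
Hypothesis K0_inv : invariant_compact Sm K0.
Hypothesis eps_gt0 : 0 < eps.
Hypothesis K0_sep : forall j (k1 k2 : 'I_(N j).+1), k1 != k2 ->
  forall x y, K0 x -> K0 y -> eps <= enorm (Sm j k1 x - Sm j k2 y).
Variable K : (nat -> 'I_m.+1) -> set 'rV[R]_d.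
Hypothesis K_attr : is_random_attractor Sm K.
Variable mu : (nat -> 'I_m.+1) -> probability (borelRd R d) R.
Hypothesis mu_self : is_random_measure Sm p K mu.
Variables (omega : nat -> 'I_m.+1) (k : nat -> nat) (x : 'rV[R]_d).
Hypothesis vk : valid_code N omega k.
Hypothesis ck : codes Sm K0 omega k x.

Let approx (delta : R) M : 0 < delta -> \forall e \near (0 : R)^'+, exists n q,
    [/\ (M <= n)%N, log_quotient (mu omega) x e = q%:E &
        `|q - symbolic_dim r p omega k n| <= delta].
Proof.
move=> d0.
have [e0 e00 h] := log_quotient_approx r_bounds Sm_sim p_gt0 K0_inv eps_gt0 K0_sep
  K_attr mu_self vk ck M d0.
by near=> e; apply: h; apply/andP.
Unshelve. all: by end_near. Qed.

Lemma has_local_dim_symbolic (a : R) :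
  (forall delta, 0 < delta -> exists M, forall n, (M <= n)%N ->
    `|symbolic_dim r p omega k n - a| <= delta) ->
  has_local_dim (mu omega) x a%:E.
Proof.
move=> h; apply/fine_cvgP; split.
  have := approx 0 ltr01; apply: filterS => e [n [q [_ -> _]]].
  by rewrite fin_numE.
apply/cvgrPdist_le => delta d0.
have d2 : 0 < delta / 2 by rewrite divr_gt0.
have [M hM] := h _ d2; have := approx M d2; apply: filterS => e [n [q [nM /= -> qn]]].
have := hM n nM; move: qn; rewrite /= !ler_norml => /andP[? ?] /andP[? ?].
by apply/andP; split; lra.
Qed.

Lemma local_dim_bounds (a b : R) :
  (forall delta, 0 < delta -> exists M, forall n, (M <= n)%N ->
    a - delta <= symbolic_dim r p omega k n <= b + delta) ->
  [/\ exists2 l, l \in `[a, b] & lower_local_dim (mu omega) x = l%:E,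
    exists2 l, l \in `[a, b] & upper_local_dim (mu omega) x = l%:E &
    forall l, has_local_dim (mu omega) x l -> exists2 l', l' \in `[a, b] & l = l'%:E].
Proof.
move=> h.
have near_ab delta : 0 < delta -> \forall e \near (0 : R)^'+,
    ((a - delta)%:E <= log_quotient (mu omega) x e <= (b + delta)%:E)%E.
  move=> d0; have d2 : 0 < delta / 2 by rewrite divr_gt0.
  have [M hM] := h _ d2; have := approx M d2; apply: filterS => e [n [q [nM -> qn]]].
  have /andP[? ?] := hM n nM; move: qn; rewrite ler_norml => /andP[? ?].
  by rewrite !lee_fin; apply/andP; split; lra.
have squeeze (l : \bar R) : (forall delta : R, 0 < delta ->
    ((a - delta)%:E <= l <= (b + delta)%:E)%E) -> exists2 l', l' \in `[a, b] & l = l'%:E.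
  case: l => [l hl||]; last 2 first.
  - by move=> /(_ _ ltr01) /andP[_]; rewrite leye_eq.
  - by move=> /(_ _ ltr01) /andP[+ _]; rewrite leeNy_eq.
  exists l => //; rewrite in_itv /=; apply/andP; split; apply/ler_addgt0Pr => e e0;
    have := hl e e0; rewrite !lee_fin => /andP[? ?]; lra.
split.
- apply: squeeze => delta /near_ab ab; apply/andP; split.
    by apply: limf_einf_ge; apply: filterS ab => e /andP[].
  by apply: limf_einf_le; apply: filterS ab => e /andP[].
- apply: squeeze => delta /near_ab ab; apply/andP; split.
    by apply: limf_esup_ge; apply: filterS ab => e /andP[].
  by apply: limf_esup_le; apply: filterS ab => e /andP[].
move=> l hl; apply: squeeze => delta /near_ab ab; apply/andP; split.
  by apply: cvge_ge hl; apply: filterS ab => e /andP[].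
by apply: cvge_le hl; apply: filterS ab => e /andP[].
Qed.

Lemma upper_lower_of_has_local_dim (a : R) : has_local_dim (mu omega) x a%:E ->
  lower_local_dim (mu omega) x = a%:E /\ upper_local_dim (mu omega) x = a%:E.
Proof.
move=> /fine_cvgP[fin /cvgrPdist_le cv].
have near_a delta : 0 < delta -> \forall e \near (0 : R)^'+,
    ((a - delta)%:E <= log_quotient (mu omega) x e <= (a + delta)%:E)%E.
  move=> d0; near=> e.
  have fe : log_quotient (mu omega) x e \is a fin_num by near: e.
  have : `|a - fine (log_quotient (mu omega) x e)| <= delta by near: e; exact: cv.
  rewrite -(fineK fe) !lee_fin /= ler_norml => /andP[? ?].
  by apply/andP; split; lra.
split; apply/eqP; rewrite eq_le; apply/andP; split.
- apply/lee_addgt0Pr => e e0; rewrite -EFinD; apply: limf_einf_le.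
  by apply: filterS (near_a _ e0) => t /andP[].
- apply/lee_subgt0Pr => e e0; rewrite -EFinB; apply: limf_einf_ge.
  by apply: filterS (near_a _ e0) => t /andP[].
- apply/lee_addgt0Pr => e e0; rewrite -EFinD; apply: limf_esup_le.
  by apply: filterS (near_a _ e0) => t /andP[].
- apply/lee_subgt0Pr => e e0; rewrite -EFinB; apply: limf_esup_ge.
  by apply: filterS (near_a _ e0) => t /andP[].
Unshelve. all: by end_near. Qed.

(** An upper or lower limit is approached at arbitrarily late levels only, which is all that a cover
    needs. *)
Lemma symbolic_dim_frequently (a : R) :
  upper_local_dim (mu omega) x = a%:E \/ lower_local_dim (mu omega) x = a%:E ->
  forall delta M, 0 < delta -> exists2 n, (M <= n)%N &
    `|symbolic_dim r p omega k n - a| <= delta.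
Proof.
move=> hul delta M d0; have d2 : 0 < delta / 2 by rewrite divr_gt0.
have [e [n [q [nM qE qn]]]] : exists2 e, (exists n q,
    [/\ (M <= n)%N, log_quotient (mu omega) x e = q%:E &
        `|q - symbolic_dim r p omega k n| <= delta / 2]) &
    ((a - delta / 2)%:E < log_quotient (mu omega) x e < (a + delta / 2)%:E)%E.
  by case: hul => hul; [apply: (limf_esup_frequently hul d2)|
    apply: (limf_einf_frequently hul d2)]; exact: approx.
rewrite qE !lte_fin => /andP[? ?]; exists n => //.
by move: qn; rewrite !ler_norml => /andP[? ?]; apply/andP; split; lra.
Qed.

End dimension_transfer.

(** * Bounds on Hausdorff measures *)

Lemma sum_sub_uniq (R : realType) (T : eqType) (s t : seq T) (g : T -> R) :
  (forall u, 0 <= g u) -> uniq s -> {subset s <= t} ->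
  \sum_(u <- s) g u <= \sum_(u <- t) g u.
Proof.
move=> g0; elim: s t => [|a s IH] t /=; first by rewrite big_nil sumr_ge0.
move=> /andP[a_s us] st; rewrite big_cons [leRHS](big_rem a) ?st ?mem_head//=.
rewrite lerD2l; apply: IH => // u us'; apply: rem_mem.
  by apply: contraNneq a_s => <-.
by apply: st; rewrite inE us' orbT.
Qed.

Lemma diam_set0 (R : realType) (d : nat) : diam (set0 : set 'rV[R]_d) = -oo%E.
Proof.
rewrite /diam (_ : [set _ | _ in _ & _ in _] = set0) ?ereal_sup0//.
by apply/seteqP; split => // x [y []].
Qed.

Section hausdorff_upper.
Variables (R : realType) (d m : nat) (N : 'I_m.+1 -> nat).
Variables (Sm : forall j, 'I_(N j).+1 -> 'rV[R]_d -> 'rV[R]_d).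
Variables (r : forall j, 'I_(N j).+1 -> R).
Arguments Sm : clear implicits.
Arguments r : clear implicits.
Hypothesis r_bounds : forall j k, 0 < r j k < 1.
Hypothesis Sm_sim : forall j k, similitude (r j k) (Sm j k).
Variables (K0 : set 'rV[R]_d).
Hypothesis K0_inv : invariant_compact Sm K0.

Let lr := log_of r.
Arguments lr : clear implicits.

Lemma word_ratio_le : exists2 c, 0 < c &
  forall omega u, word_ratio r omega u <= expR (- (c * (size u)%:R)).
Proof.
have [c c0 cP] := exists_neg_bound (log_of_lt0 r_bounds).
exists c => // omega u; rewrite ler_expR -mulNr -(@birkhoff_const R m N _ omega).
by apply: ler_birkhoff => j a; exact: cP.
Qed.

(** The cover consists of all long cylinders whose ratio to the power [s] is at most the exponential
    of the sum of [phi]; adding over all lengths gives the tail of a geometric series. *)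
Lemma hausdorff_meas_eq0 omega (phi : forall j, 'I_(N j).+1 -> R) s (A : set 'rV[R]_d)
    (C rho : R) : 0 <= s -> 0 < rho < 1 ->
  (forall n, \sum_(u <- words_of N omega n) expR (birkhoff phi omega u) <= C * rho ^+ n) ->
  (forall x, A x -> forall M, exists u, [/\ (M <= size u)%N, valid_word N omega u,
     s * birkhoff lr omega u <= birkhoff phi omega u &
     exists2 y, K0 y & x = word_map Sm omega u y]) ->
  hausdorff_meas s A = 0%E.
Proof.
move=> s0 /andP[rho0 rho1] sumC covA.
have [K0n K0c _] := K0_inv.
have [D D0 KD] := compact_enorm_bounded K0c.
have [c c0 cP] := word_ratio_le.
have C0 : 0 <= C.
  have := sumC 0%N; rewrite /= big_cons big_nil addr0 expR0 expr0 mulr1.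
  exact: le_trans.
have pre_ge0 delta : (0 <= hausdorff_pre s delta A)%E.
  apply: le_ereal_inf_tmp => _ [U _ <-]; apply: nneseries_ge0 => i _ _.
  by rewrite /diam_pow; case: ifP => // _; exact: poweR_ge0.
apply/eqP; rewrite eq_le; apply/andP; split; last first.
  apply: le_trans (pre_ge0 1) _; apply: ereal_sup_ubound; exists 1 => //=.
apply: ge_ereal_sup => _ [delta /= delta0 <-].
apply/lee_addgt0Pr => e e0; rewrite add0e.
(* One length serves two purposes: diameters below [delta] and total cost below [e]. *)
have [n0 n0d n0e] : exists2 n0, forall n, (n0 <= n)%N -> D * expR (- (c * n%:R)) <= delta &
    D `^ s * (C * rho ^+ n0 / (1 - rho)) <= e.
  have h1 : \forall n \near \oo, D `^ s * C / (1 - rho) * rho ^+ n <= e.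
    have := @cvg_expr R rho; rewrite ger0_norm ?(ltW rho0)// => /(_ rho1) cv.
    have : D `^ s * C / (1 - rho) * rho ^+ n @[n --> \oo] -->
        D `^ s * C / (1 - rho) * 0 by apply: cvgMl_tmp.
    rewrite mulr0 => /cvgrPdist_le /(_ e e0); apply: filterS => n; rewrite sub0r normrN.
    by apply: le_trans; exact: ler_norm.
  have [n1 _ h1'] := h1.
  have [n2 n2P] := expR_decay_le D0 delta0 c0.
  exists (maxn n1 n2) => [n|]; last first.
    have := h1' (maxn n1 n2) (leq_maxl _ _); apply: le_trans.
    by rewrite !mulrA mulrAC.
  by rewrite geq_max => /andP[_ /n2P].
pose Q u := [&& (n0 <= size u)%N, valid_word N omega u &
  s * birkhoff lr omega u <= birkhoff phi omega u].
(* Words are enumerated by their codes as a countable type; an index without an accepted word gets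
   the empty set, which costs 0. *)
pose U i : set 'rV[R]_d := if pickle_inv i is Some u then
  if Q u then word_map Sm omega u @` K0 else set0 else set0.
have diamU u : (diam (word_map Sm omega u @` K0) <= (D * word_ratio r omega u)%:E)%E.
  apply: ge_ereal_sup => _ [_ [y Ky <-]] [_ [z Kz <-]] <-.
  rewrite lee_fin (word_map_ratio r_bounds Sm_sim) mulrC ler_wpM2r ?KD//.
  exact/ltW/word_ratio_gt0.
apply: (@le_trans _ _ (\sum_(i <oo) diam_pow s (U i))%E).
  apply: ereal_inf_lbound; exists U => //=; split.
    move=> x /covA/(_ n0)[u [nu uN su [y Ky xy]]].
    exists (pickle u) => //; rewrite /U pickleK_inv /Q nu uN su /=.
    by exists y.
  move=> i; rewrite /U; case: (pickle_inv i) => [u|]; last first.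
    by rewrite diam_set0 leNye.
  case: ifP => [/and3P[nu uN su]|_]; last by rewrite diam_set0 leNye.
  apply: (le_trans (diamU u)); rewrite lee_fin (le_trans _ (n0d _ nu))//.
  by apply: ler_wpM2l; [exact: ltW|exact: cP].
pose h u : R := if Q u then D `^ s * expR (birkhoff phi omega u) else 0.
have h0 u : 0 <= h u by rewrite /h; case: ifP => // _; rewrite mulr_ge0 ?powR_ge0 ?expR_ge0.
have dU i : (diam_pow s (U i) <= (if pickle_inv i is Some u then h u else 0)%:E)%E.
  rewrite /U /h /diam_pow; case: (pickle_inv i) => [u|]; last by rewrite eqxx.
  case: (boolP (Q u)) => [Qu|_]; last by rewrite eqxx.
  case: ifP => [_|/negbT une]; first by rewrite lee_fin mulr_ge0 ?powR_ge0 ?expR_ge0.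
  have diam0 : (0 <= diam (word_map Sm omega u @` K0))%E.
    have [y Ky] := K0n; apply: (@le_trans _ _ (enorm (word_map Sm omega u y -
      word_map Sm omega u y))%:E); first by rewrite lee_fin enorm_ge0.
    apply: ereal_sup_ubound; exists (word_map Sm omega u y); first by exists y.
    by exists (word_map Sm omega u y); first by exists y.
  have Dr0 : 0 <= D * word_ratio r omega u.
    by apply: mulr_ge0; apply: ltW => //; exact: word_ratio_gt0.
  apply: le_trans (gt0_ler_poweR s0 _ _ (diamU u)) _.
  - by rewrite in_itv /= leey andbT.
  - by rewrite in_itv /= leey andbT lee_fin.
  rewrite poweR_EFin lee_fin powRM; [|exact: ltW|exact/ltW/word_ratio_gt0].
  rewrite ler_wpM2l ?powR_ge0// /powR gt_eqF ?word_ratio_gt0// expRK ler_expR.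
  by case/and3P : Qu.
apply: lime_le.
  apply: is_cvg_nneseries => i _ _; rewrite /diam_pow; case: ifP => // _; exact: poweR_ge0.
apply: nearW => M.
apply: (@le_trans _ _ (\sum_(0 <= i < M)
    (if pickle_inv i is Some u then h u else 0)%:E)%E); first exact: lee_sum.
rewrite sumEFin lee_fin.
pose W := pmap (@pickle_inv (seq nat)) (iota 0 M).
have -> : \sum_(0 <= i < M) (if pickle_inv i is Some u then h u else 0) =
    \sum_(u <- W) h u.
  rewrite /W /index_iota subn0; elim: (iota 0 M) => [|i l IH]; first by rewrite !big_nil.
  rewrite big_cons IH /=; case: (pickle_inv i) => [u|] /=; last by rewrite add0r.
  by rewrite big_cons.
rewrite /h -big_mkcond /= -mulr_sumr -big_filter.
(* The accepted words in a partial sum are distinct and shorter than [L], so they occur among the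
   words of lengths [n0] to [L - 1]. *)
pose L := (\max_(u <- W) size u).+1.
pose T := flatten [seq words_of N omega n | n <- iota n0 (L - n0)].
apply: (@le_trans _ _ (D `^ s * \sum_(u <- T) expR (birkhoff phi omega u))).
  rewrite ler_wpM2l ?powR_ge0//; apply: sum_sub_uniq => [u||u].
  - exact: expR_ge0.
  - apply: filter_uniq; apply: pmap_uniq (iota_uniq _ _); exact: pickle_invK.
  - rewrite mem_filter => /andP[/and3P[nu uN _] uW].
    apply/flattenP; exists (words_of N omega (size u)); last by rewrite mem_words_of eqxx.
    apply: map_f; rewrite mem_iota nu /= subnKC.
      by rewrite ltnS; exact: leq_bigmax_seq.
    by rewrite (leq_trans nu)// ltnW// ltnS; exact: leq_bigmax_seq.
apply: le_trans n0e; rewrite ler_wpM2l ?powR_ge0//.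
rewrite /T big_flatten big_map /=.
apply: (@le_trans _ _ (\sum_(n <- iota n0 (L - n0)) C * rho ^+ n)).
  by apply: ler_sum => n _.
rewrite -mulr_sumr -mulrA ler_wpM2l//.
have -> : \sum_(n <- iota n0 (L - n0)) rho ^+ n =
    series (geometric (rho ^+ n0) rho) (L - n0)%N.
  rewrite /series /= -[n0 in iota n0 _]addn0 iotaDl big_map /index_iota subn0.
  by apply: eq_bigr => i _; rewrite exprD.
by apply: geometric_le_lim; rewrite ?exprn_ge0 ?ltW// ger0_norm ?ltW.
Qed.

End hausdorff_upper.

Section hausdorff_lower.
Variables (R : realType) (d m : nat) (N : 'I_m.+1 -> nat).
Variables (Sm : forall j, 'I_(N j).+1 -> 'rV[R]_d -> 'rV[R]_d).
Variables (r : forall j, 'I_(N j).+1 -> R).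
Arguments Sm : clear implicits.
Arguments r : clear implicits.
Hypothesis r_bounds : forall j k, 0 < r j k < 1.
Hypothesis Sm_sim : forall j k, similitude (r j k) (Sm j k).
Variables (K0 : set 'rV[R]_d) (eps : R).
Hypothesis K0_inv : invariant_compact Sm K0.
Hypothesis eps_gt0 : 0 < eps.
Hypothesis K0_sep : forall j (k1 k2 : 'I_(N j).+1), k1 != k2 ->
  forall x y, K0 x -> K0 y -> eps <= enorm (Sm j k1 x - Sm j k2 y).

Let lr := log_of r.
Arguments lr : clear implicits.

(* The set [G] of codes need not be measurable: the only mass ever used is that
   of the countably many cylinders of [c], through the avoidance hypothesis. *)
Lemma hausdorff_meas_neq0 omega (w : forall j, 'I_(N j).+1 -> R)
    (lw : forall j, 'I_(N j).+1 -> R) (G : set (nat -> nat)) (A : set 'rV[R]_d)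
    s0 s C :
  (forall j k, 0 <= w j k <= expR (lw j k)) -> 0 <= s0 < s ->
  (forall k n, G k -> birkhoff lw omega (mkseq k n) <=
     C + s * birkhoff lr omega (mkseq k n)) ->
  (forall k x, valid_code N omega k -> G k -> codes Sm K0 omega k x -> A x) ->
  (forall (b : pred nat) (c : nat -> seq nat),
    (\sum_(i <oo) (if b i then cyl_mass w omega (c i) [::] else 0)%:E < (2^-1)%:E)%E ->
    exists k, [/\ valid_code N omega k, G k & forall i n, b i -> c i <> mkseq k n]) ->
  hausdorff_meas s0 A != 0%E.
Proof.
move=> wlw /andP[s00 s0s] massG GA avoid; apply/negP => /eqP meas0.
have s_gt0 : 0 < s by exact: le_lt_trans s0s.
(* A cylinder of ratio at most [t / eps] has mass at most [E] times the power [s] of [t]. The value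
   of [eta] below makes the total mass to be avoided at most [E * (eta + eta)], that is 1/4. *)
pose E := expR C * (eps `^ s)^-1.
have E0 : 0 < E by rewrite mulr_gt0 ?expR_gt0 ?invr_gt0 ?powR_gt0.
pose eta := (8 * E)^-1.
have eta0 : 0 < eta by rewrite invr_gt0 mulr_gt0.
(* Diameters at most 1 allow the exponent [s] to be lowered to [s0]. *)
have : (hausdorff_pre s0 1 A < eta%:E)%E.
  apply: (@le_lt_trans _ _ (hausdorff_meas s0 A)); last by rewrite meas0 lte_fin.
  by apply: ereal_sup_ubound; exists 1 => //=.
move=> /ereal_inf_lt[_ [U [AU U1] <-] Ueta].
pose good i x := U i x /\ exists k, [/\ valid_code N omega k, G k & codes Sm K0 omega k x].
have word_ratio_cvg k t : 0 < t -> exists n, eps * word_ratio r omega (mkseq k n) <= t.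
  move=> t0; have [c c0 cP] := word_ratio_le r_bounds.
  have [n /(_ n (leqnn n)) nP] := expR_decay_le eps_gt0 t0 c0.
  by exists n; rewrite (le_trans _ nP)// ler_pM2l// (le_trans (cP _ _))// size_mkseq.
(* A positive scale in place of the diameter, which may be 0 and would then select no finite level;
   the powers [s] of these scales have sum at most [eta]. *)
pose tau i := (eta / (2 ^ i.+1)%:R) `^ s^-1.
have tau0 i : 0 < tau i by rewrite powR_gt0// divr_gt0// ltr0n expn_gt0.
have tauE i : tau i `^ s = eta / (2 ^ i.+1)%:R.
  by rewrite -powRrM mulVf ?gt_eqF// powRr1// divr_ge0// ltW.
pose dia i := fine (diam (U i)).
have diaP i x : U i x -> [/\ 0 <= dia i, dia i <= 1,
    (dia i)%:E = diam (U i) & diam_pow s0 (U i) = (dia i `^ s0)%:E].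
  move=> Ux; have h0 : (0 <= diam (U i))%E.
    apply: (@le_trans _ _ (enorm (x - x))%:E); first by rewrite lee_fin enorm_ge0.
    by apply: ereal_sup_ubound; exists x => //; exists x.
  have fE : (dia i)%:E = diam (U i).
    by rewrite fineK// ge0_fin_numE// (le_lt_trans (U1 i))// ltry.
  split => //.
  - by rewrite -lee_fin fE.
  - by rewrite -lee_fin fE.
  - rewrite /diam_pow; case: ifP => [/eqP U0|_]; first by rewrite U0 in Ux.
    by rewrite -fE poweR_EFin.
(* A set that contains the point of a good code is replaced by one cylinder, which holds all its
   coded points and has mass controlled by its diameter. *)
have pick i : exists c : seq nat, (exists x, good i x) ->
    (expR (birkhoff lw omega c) <= E * (dia i `^ s0 + eta / (2 ^ i.+1)%:R)) /\
    (forall k x, valid_code N omega k -> codes Sm K0 omega k x -> U i x ->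
      c = mkseq k (size c)).
  have [[x [Ux [k [vk Gk ck]]]]|] := pselect (exists x, good i x); last by exists [::].
  have [dia0 dia1 diaE powE] := diaP i x Ux.
  pose t := Num.max (dia i) (tau i).
  have t0 : 0 < t by rewrite lt_max tau0 orbT.
  have ex_n := word_ratio_cvg k t t0.
  pose n := ex_minn ex_n.
  have [nP nmin] : eps * word_ratio r omega (mkseq k n) <= t /\
     (forall i, eps * word_ratio r omega (mkseq k i) <= t -> (n <= i)%N).
    by rewrite /n; case: ex_minnP.
  exists (mkseq k n) => _; split.
    have h1 : expR (birkhoff lw omega (mkseq k n)) <=
        expR C * (word_ratio r omega (mkseq k n)) `^ s.
      rewrite /powR gt_eqF ?word_ratio_gt0// expRK -expRD ler_expR.
      exact: massG.
    apply: (le_trans h1); rewrite -mulrA ler_wpM2l ?expR_ge0//.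
    have h2 : word_ratio r omega (mkseq k n) <= eps^-1 * t by rewrite ler_pdivlMl.
    apply: (@le_trans _ _ ((eps^-1 * t) `^ s)).
      apply: ge0_ler_powR h2; first exact: ltW.
        by rewrite nnegrE ltW// word_ratio_gt0.
      by rewrite nnegrE ltW// mulr_gt0// invr_gt0.
    have ie0 : 0 <= eps^-1 by rewrite invr_ge0 ltW.
    rewrite powRM// ?(ltW t0)//.
    rewrite -powR_inv1 ?(ltW eps_gt0)// -powRrM mulN1r powRN.
    apply: ler_wpM2l; first by rewrite invr_ge0 powR_ge0.
    apply: (@le_trans _ _ (dia i `^ s + tau i `^ s)).
      by rewrite /t; case: (leP (dia i) (tau i)) => _; rewrite ?lerDl ?lerDr powR_ge0.
    rewrite tauE lerD2r; have [->|dn0] := eqVneq (dia i) 0.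
      by rewrite powR0 ?gt_eqF// powR_ge0.
    by apply: ger_powR; [rewrite lt_neqAle eq_sym dn0 dia0|exact: ltW].
  move=> k' x' vk' ck' Ux'; rewrite size_mkseq.
  case nE : n => [//|n'].
  apply/eqP; apply: contraT; rewrite eq_sym => kk'.
  have [z Kz xz] := ck n'.+1; have [z' Kz' xz'] := ck' n'.+1.
  have := valid_mkseq n'.+1 vk; have := valid_mkseq n'.+1 vk'.
  move=> v' v; rewrite mkseqS in v xz kk'.
  have sz : size (mkseq k' n'.+1) = (size (mkseq k n')).+1 by rewrite !size_mkseq.
  have := word_separation r_bounds Sm_sim K0_inv eps_gt0 K0_sep sz v v' kk' Kz Kz'.
  rewrite -xz -xz' => sep.
  have xx' : enorm (x - x') <= dia i.
    by rewrite -lee_fin diaE; apply: ereal_sup_ubound; exists x => //; exists x'.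
  (* Codes that diverge before level [n] would give points of [U i] too far apart, by minimality of
     [n]. *)
  suff /nmin : eps * word_ratio r omega (mkseq k n') <= t by rewrite nE ltnn.
  by rewrite (le_trans sep)// (le_trans xx')// le_max lexx.
have /choice[c cP] := pick.
pose b i := `[< exists x, good i x >].
have [|k [vk Gk kav]] := avoid b c.
  apply: (@le_lt_trans _ _ (\sum_(i <oo) (E%:E * (diam_pow s0 (U i) +
      (eta / (2 ^ i.+1)%:R)%:E)))%E).
    have dp0 i : (0 <= diam_pow s0 (U i))%E.
      by rewrite /diam_pow; case: ifP => // _; exact: poweR_ge0.
    have cw j a : 0 <= w j a by have /andP[] := wlw j a.
    apply: lee_nneseries => [i _ _|i _].
      by rewrite lee_fin; case: ifP => // _; exact: cyl_mass_ge0.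
    case: ifP => [/asboolP bi|_]; last first.
      by rewrite mule_ge0 ?lee_fin ?(ltW E0)// adde_ge0// lee_fin divr_ge0// ltW.
    have [x [Ux _]] := bi; have [_ _ _ ->] := diaP i x Ux.
    have [h _] := cP i bi; rewrite -EFinD -EFinM lee_fin.
    by rewrite (le_trans (cyl_mass_le _ _ wlw)).
  have dp0 i : (0 <= diam_pow s0 (U i))%E.
    by rewrite /diam_pow; case: ifP => // _; exact: poweR_ge0.
  have ep0 i : (0 <= (eta / (2 ^ i.+1)%:R)%:E :> \bar R)%E.
    by rewrite lee_fin divr_ge0// ltW.
  rewrite nneseriesZl; last by move=> i _; rewrite adde_ge0.
  rewrite nneseriesD//.
  have h := @epsilon_trick0 R eta xpredT (ltW eta0).
  apply: (@le_lt_trans _ _ (E%:E * (eta%:E + eta%:E))%E).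
    by apply: lee_wpmul2l; [rewrite lee_fin ltW|apply: leeD => //; exact: ltW].
  rewrite -EFinD -EFinM lte_fin /eta.
  have -> : E * ((8 * E)^-1 + (8 * E)^-1) = 4^-1 by field; rewrite gt_eqF.
  by lra.
(* The point of the avoiding code lies in [A], hence in some [U i], so the code begins with [c i]: a
   contradiction. *)
have [x ck] := exists_point Sm_sim K0_inv vk.
have [i _ Ux] := AU x (GA k x vk Gk ck).
have gi : exists x, good i x by exists x; split => //; exists k.
have [_ /(_ k x vk ck Ux) ci] := cP i gi.
by apply: (kav i (size (c i))) => //; apply/asboolP.
Qed.

End hausdorff_lower.

(** * Multifractal spectrum *)

Section typical_words.
Variables (R : realType) (m : nat) (theta : 'I_m.+1 -> R).
Hypothesis theta_gt0 : forall j, 0 < theta j.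
Hypothesis theta_sum : \sum_j theta j = 1.
Variables (N : 'I_m.+1 -> nat).
Implicit Types (f phi : forall j, 'I_(N j).+1 -> R).
Variable omega : nat -> 'I_m.+1.
Hypothesis omega_good : good_word theta omega.

(** Minimising [phi] letter by letter gives a tuple; the letter frequencies turn the minimal sum
    into [n] times its mean, uniformly over all codes. *)
Lemma birkhoff_ge_tuple phi : (forall k, 0 <= tuple_mean theta phi k) ->
  forall delta, 0 < delta -> exists C, forall k n,
    - (delta * n%:R + C) <= birkhoff phi omega (mkseq k n).
Proof.
move=> phi0 delta d0.
pose k0 : {dffun forall j : 'I_m.+1, 'I_(N j).+1} :=
  [ffun j => [arg min_(a < ord0) phi j a]%O].
have k0P j a : phi j (k0 j) <= phi j a.
  by rewrite ffunE; case: arg_minP => // i _; apply.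
have [C CP] := omega_good (fun j => phi j (k0 j)) d0.
exists C => k n.
apply: (@le_trans _ _ (birkhoff (fun j _ => phi j (k0 j)) omega (mkseq k n))).
  rewrite birkhoff_letter size_mkseq.
  have := CP n; rewrite ler_norml => /andP[+ _]; move=> /le_trans; apply.
  by rewrite gerBl mulr_ge0//; exact: phi0.
by apply: ler_birkhoff => j a; exact: k0P.
Qed.

(** Half of [delta] pays for the digits around their conditional means, half for these means around
    their average under theta. *)
Lemma birkhoff_good_code (w : forall j, 'I_(N j).+1 -> R) f (C : R -> R) :
  forall delta, 0 < delta -> exists C', forall k,
  (forall delta n, 0 < delta ->
    `|birkhoff (centered w f) omega (mkseq k n)| <= delta * n%:R + C delta) ->
  forall n, `|birkhoff f omega (mkseq k n) - n%:R * \sum_j theta j * wmean w f j|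
    <= delta * n%:R + C'.
Proof.
move=> delta d0; have d2 : 0 < delta / 2 by rewrite divr_gt0.
have [C1 C1P] := omega_good (wmean w f) d2.
exists (C (delta / 2) + C1) => k kP n.
have h2 := kP _ n d2; have h1 := C1P n.
rewrite (birkhoff_centered w f) size_mkseq -addrA.
rewrite (le_trans (ler_normD _ _))// (le_trans (lerD h2 h1))//.
by rewrite addrACA -mulrDl -splitr.
Qed.

End typical_words.

Lemma eventually_linear (R : realType) (c delta : R) (C : R) : 0 < c -> 0 < delta ->
  exists M, forall n, (M <= n)%N -> (delta * c / 2) * n%:R + C <= delta * (c * n%:R).
Proof.
move=> c0 d0.
have dc0 : 0 < delta * c / 2 by rewrite divr_gt0// mulr_gt0.
exists (Num.truncn (`|C| / (delta * c / 2))).+1 => n Mn.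
have h : `|C| / (delta * c / 2) <= n%:R.
  by rewrite (@le_trans _ _ (Num.truncn (`|C| / (delta * c / 2))).+1%:R) ?ler_nat//
    ltW// truncnS_gt.
rewrite ler_pdivrMr// in h.
by have := ler_norm C; lra.
Qed.

Section assembly.
Variables (R : realType) (d m : nat) (theta : 'I_m.+1 -> R).
Hypothesis theta_gt0 : forall j, 0 < theta j.
Hypothesis theta_sum : \sum_j theta j = 1.
Variables (N : 'I_m.+1 -> nat).
Variables (Sm : forall j, 'I_(N j).+1 -> 'rV[R]_d -> 'rV[R]_d).
Variables (r p : forall j, 'I_(N j).+1 -> R).
Arguments Sm : clear implicits.
Arguments r : clear implicits.
Arguments p : clear implicits.
Hypothesis r_bounds : forall j k, 0 < r j k < 1.
Hypothesis Sm_sim : forall j k, similitude (r j k) (Sm j k).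
Hypothesis p_gt0 : forall j k, 0 < p j k.
Hypothesis p_sum : forall j, \sum_k p j k = 1.
Variables (K0 : set 'rV[R]_d) (eps : R).
Hypothesis K0_inv : invariant_compact Sm K0.
Hypothesis eps_gt0 : 0 < eps.
Hypothesis K0_sep : forall j (k1 k2 : 'I_(N j).+1), k1 != k2 ->
  forall x y, K0 x -> K0 y -> eps <= enorm (Sm j k1 x - Sm j k2 y).
Variable K : (nat -> 'I_m.+1) -> set 'rV[R]_d.
Hypothesis K_attr : is_random_attractor Sm K.
Variable mu : (nat -> 'I_m.+1) -> probability (borelRd R d) R.
Hypothesis mu_self : is_random_measure Sm p K mu.
Variable omega : nat -> 'I_m.+1.
Hypothesis omega_good : good_word theta omega.

Let lr := log_of r.
Let lp := log_of p.
Arguments lr : clear implicits.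
Arguments lp : clear implicits.

Let lr_lt0 j k : lr j k < 0.
Proof. exact: log_of_lt0. Qed.

Lemma symbolic_dim_le k a :
  (forall delta, 0 < delta -> exists C, forall n, - (delta * n%:R + C) <=
    birkhoff lp omega (mkseq k n) - a * birkhoff lr omega (mkseq k n)) ->
  forall delta, 0 < delta -> exists M, forall n, (M <= n)%N ->
    symbolic_dim r p omega k n <= a + delta.
Proof.
move=> h delta d0; have [c c0 cP] := birkhoff_lr_le r_bounds.
(* The denominator is at most [- (c * n%:R)], so an error of slope [delta * c / 2] leaves room for
   the constant. *)
have dc0 : 0 < delta * c / 2 by rewrite divr_gt0// mulr_gt0.
have [C CP] := h _ dc0; have [M MP] := eventually_linear C c0 d0.
exists M.+1 => n Mn; have n0 : (0 < n)%N by exact: leq_ltn_trans Mn.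
have := cP omega k n; have := CP n; have := MP n (ltnW Mn).
have cn : 0 < c * n%:R by rewrite mulr_gt0// ltr0n.
rewrite /symbolic_dim -/lr -/lp.
set P := birkhoff lp _ _; set Q := birkhoff lr _ _ => h1 h2 h3.
have Q0 : Q < 0 by rewrite (le_lt_trans h3)// oppr_lt0.
rewrite ler_ndivrMr// mulrDl.
have : delta * Q <= delta * - (c * n%:R) by rewrite ler_pM2l.
by lra.
Qed.

Lemma symbolic_dim_ge k a :
  (forall delta, 0 < delta -> exists C, forall n,
    birkhoff lp omega (mkseq k n) - a * birkhoff lr omega (mkseq k n) <=
    delta * n%:R + C) ->
  forall delta, 0 < delta -> exists M, forall n, (M <= n)%N ->
    a - delta <= symbolic_dim r p omega k n.
Proof.
move=> h delta d0; have [c c0 cP] := birkhoff_lr_le r_bounds.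
have dc0 : 0 < delta * c / 2 by rewrite divr_gt0// mulr_gt0.
have [C CP] := h _ dc0; have [M MP] := eventually_linear C c0 d0.
exists M.+1 => n Mn; have n0 : (0 < n)%N by exact: leq_ltn_trans Mn.
have := cP omega k n; have := CP n; have := MP n (ltnW Mn).
have cn : 0 < c * n%:R by rewrite mulr_gt0// ltr0n.
rewrite /symbolic_dim -/lr -/lp.
set P := birkhoff lp _ _; set Q := birkhoff lr _ _ => h1 h2 h3.
have Q0 : Q < 0 by rewrite (le_lt_trans h3)// oppr_lt0.
rewrite ler_ndivlMr// mulrBl.
have : delta * Q <= delta * - (c * n%:R) by rewrite ler_pM2l.
by lra.
Qed.

Let birkhoff_comb a u : birkhoff lp omega u - a * birkhoff lr omega u =
  birkhoff (fun j k => lp j k - a * lr j k) omega u.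
Proof.
rewrite -mulNr -birkhoffZ -birkhoffD; apply: eq_birkhoff => j b.
by rewrite mulNr.
Qed.

Lemma symbolic_dim_range a b : (forall k, a <= tuple_ratio theta lr lp k <= b) ->
  forall k delta, 0 < delta -> exists M, forall n, (M <= n)%N ->
    a - delta <= symbolic_dim r p omega k n <= b + delta.
Proof.
move=> ab k delta d0.
(* As the mean of [lr] is negative, comparing a ratio with [c] becomes a sign condition on one tuple
   mean. *)
have tm c t : tuple_mean theta (fun j k => lp j k - c * lr j k) t =
    tuple_mean theta lr t * (tuple_ratio theta lr lp t - c).
  have t0 := tuple_mean_lr_lt0 theta_gt0 lr_lt0 t.
  rewrite mulrBr /tuple_ratio [X in X - _]mulrC divfK ?lt_eqF//.
  rewrite /tuple_mean mulr_suml -sumrB; apply: eq_bigr => j _; ring.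
have [M1 M1P] : exists M, forall n, (M <= n)%N ->
    symbolic_dim r p omega k n <= b + delta.
  apply: symbolic_dim_le d0 => e e0.
  have [|C CP] := @birkhoff_ge_tuple R m theta N omega omega_good
    (fun j k => lp j k - b * lr j k) _ e e0.
    move=> t; rewrite tm mulr_le0//.
      exact/ltW/(tuple_mean_lr_lt0 theta_gt0 lr_lt0).
    by rewrite subr_le0; have /andP[] := ab t.
  by exists C => n; rewrite birkhoff_comb.
have [M2 M2P] : exists M, forall n, (M <= n)%N ->
    a - delta <= symbolic_dim r p omega k n.
  apply: symbolic_dim_ge d0 => e e0.
  have [|C CP] := @birkhoff_ge_tuple R m theta N omega omega_good
    (fun j k => - 1 * (lp j k - a * lr j k)) _ e e0.
    move=> t; have -> : tuple_mean theta (fun j k => - 1 * (lp j k - a * lr j k)) t =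
        - tuple_mean theta (fun j k => lp j k - a * lr j k) t.
      by rewrite /tuple_mean -sumrN; apply: eq_bigr => j _; ring.
    rewrite tm oppr_ge0 mulr_le0_ge0//.
      exact/ltW/(tuple_mean_lr_lt0 theta_gt0 lr_lt0).
    by rewrite subr_ge0; have /andP[] := ab t.
  exists C => n; rewrite birkhoff_comb.
  by have := CP k n; rewrite birkhoffZ mulN1r lerN2.
exists (maxn M1 M2) => n; rewrite geq_max => /andP[n1 n2].
by rewrite M1P// M2P.
Qed.

Lemma has_local_dim_of_good_code w (C : R -> R) a k x :
  \sum_j theta j * wmean w lp j = a * \sum_j theta j * wmean w lr j ->
  valid_code N omega k -> codes Sm K0 omega k x ->
  (forall delta n, 0 < delta ->
    `|birkhoff (centered w lp) omega (mkseq k n)| <= delta * n%:R + C delta) ->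
  (forall delta n, 0 < delta ->
    `|birkhoff (centered w lr) omega (mkseq k n)| <= delta * n%:R + C delta) ->
  has_local_dim (mu omega) x a%:E.
Proof.
move=> wa vk ck gp gr.
have lin delta : 0 < delta -> exists C, forall n,
    `|birkhoff lp omega (mkseq k n) - a * birkhoff lr omega (mkseq k n)|
      <= delta * n%:R + C.
  move=> d0; pose e := delta / (1 + `|a|).
  have a0 : 0 < 1 + `|a| by rewrite ltr_pwDl.
  have e0 : 0 < e by rewrite divr_gt0.
  have [C1 /(_ k gp) h1] := birkhoff_good_code omega_good w lp C e0.
  have [C2 /(_ k gr) h2] := birkhoff_good_code omega_good w lr C e0.
  exists (C1 + `|a| * C2) => n.
  have -> : birkhoff lp omega (mkseq k n) - a * birkhoff lr omega (mkseq k n) =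
    (birkhoff lp omega (mkseq k n) - n%:R * \sum_j theta j * wmean w lp j) -
    a * (birkhoff lr omega (mkseq k n) - n%:R * \sum_j theta j * wmean w lr j).
    by rewrite wa; ring.
  rewrite (le_trans (ler_normB _ _))// normrM.
  rewrite (le_trans (lerD (h1 n) (ler_wpM2l (normr_ge0 a) (h2 n))))//.
  rewrite le_eqVlt; apply/orP; left; apply/eqP; rewrite /e; field.
  by rewrite gt_eqF.
apply: (has_local_dim_symbolic r_bounds Sm_sim p_gt0 K0_inv eps_gt0 K0_sep
  K_attr mu_self vk ck) => delta d0.
have [|M1 M1P] := @symbolic_dim_le k a _ delta d0.
  move=> e /lin[C' CP]; exists C' => n.
  by have := CP n; rewrite ler_norml => /andP[].
have [|M2 M2P] := @symbolic_dim_ge k a _ delta d0.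
  move=> e /lin[C' CP]; exists C' => n.
  by have := CP n; rewrite ler_norml => /andP[].
exists (maxn M1 M2) => n; rewrite geq_max => /andP[/M1P ? /M2P ?].
by rewrite ler_norml; apply/andP; split; lra.
Qed.

(** The weights mix the point masses at [k1] and [k2]. Weights equal to 0 are allowed, so the two
    extreme ratios are attained as well. *)
Lemma exists_has_local_dim a k1 k2 :
  tuple_ratio theta lr lp k1 <= a <= tuple_ratio theta lr lp k2 ->
  exists2 x, K omega x & has_local_dim (mu omega) x a%:E.
Proof.
move=> /andP[a1 a2].
have R1 := tuple_mean_lr_lt0 theta_gt0 lr_lt0 k1.
have R2 := tuple_mean_lr_lt0 theta_gt0 lr_lt0 k2.
set r1 := tuple_mean theta lr k1 in R1; set r2 := tuple_mean theta lr k2 in R2.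
have p1E : tuple_mean theta lp k1 = tuple_ratio theta lr lp k1 * r1.
  by rewrite /tuple_ratio divfK// lt_eqF.
have p2E : tuple_mean theta lp k2 = tuple_ratio theta lr lp k2 * r2.
  by rewrite /tuple_ratio divfK// lt_eqF.
(* For mixing weight [t], the equation between the mean of [lp] and [a] times the mean of [lr] reads
   [t * Y = (1 - t) * X]; if [X + Y = 0], both sides vanish. *)
pose X := (a - tuple_ratio theta lr lp k1) * - r1.
pose Y := (tuple_ratio theta lr lp k2 - a) * - r2.
have X0 : 0 <= X by rewrite mulr_ge0 ?subr_ge0// oppr_ge0 ltW.
have Y0 : 0 <= Y by rewrite mulr_ge0 ?subr_ge0// oppr_ge0 ltW.
have [t [t0 t1 tE]] : exists t, [/\ 0 <= t, t <= 1 & t * Y = (1 - t) * X].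
  have [XY|XY] := eqVneq (X + Y) 0.
    by exists 0; rewrite lexx ler01 mul0r subr0 mul1r; split => //; lra.
  have XY0 : 0 < X + Y by rewrite lt_neqAle eq_sym XY addr_ge0.
  exists (X / (X + Y)); split; first by rewrite divr_ge0// ltW.
    by rewrite ler_pdivrMr// mul1r lerDl.
  by field.
pose w j (b : 'I_(N j).+1) : R := t * (b == k2 j)%:R + (1 - t) * (b == k1 j)%:R.
have w0 j b : 0 <= w j b by rewrite addr_ge0// mulr_ge0// subr_ge0.
have sumd j (b0 : 'I_(N j).+1) (g : 'I_(N j).+1 -> R) :
    \sum_b (b == b0)%:R * g b = g b0.
  rewrite (bigD1 b0)//= eqxx mul1r big1 ?addr0// => b /negbTE ->.
  by rewrite mul0r.
have wmeanE f j : wmean w f j = t * f j (k2 j) + (1 - t) * f j (k1 j).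
  rewrite /wmean /w; under eq_bigr do rewrite mulrDl -!mulrA.
  by rewrite big_split/= -!mulr_sumr !sumd.
have w1 j : \sum_b w j b = 1.
  have := wmeanE (fun _ _ => 1) j; rewrite /wmean.
  under eq_bigr do rewrite mulr1; move=> ->; lra.
have mE f : \sum_j theta j * wmean w f j =
    t * tuple_mean theta f k2 + (1 - t) * tuple_mean theta f k1.
  rewrite /tuple_mean !mulr_sumr -big_split/=; apply: eq_bigr => j _.
  by rewrite wmeanE; ring.
have wa : \sum_j theta j * wmean w lp j = a * \sum_j theta j * wmean w lr j.
  rewrite !mE p1E p2E -/r1 -/r2; rewrite /X /Y in tE.
  by lra.
have [C] := exists_good_code w0 w1 lp lr.
move=> /(_ omega pred0 (fun=> [::]))[|k [vk gp gr _]].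
  by rewrite eseries0// lte_fin invr_gt0.
have [x ck] := exists_point Sm_sim K0_inv vk.
exists x; first exact: (codes_attractor Sm_sim K0_inv K_attr vk ck).
exact: (has_local_dim_of_good_code wa vk ck gp gr).
Qed.

End assembly.

Section level_sets.
Variables (R : realType) (d m : nat) (theta : 'I_m.+1 -> R).
Hypothesis theta_gt0 : forall j, 0 < theta j.
Hypothesis theta_sum : \sum_j theta j = 1.
Variables (N : 'I_m.+1 -> nat).
Variables (Sm : forall j, 'I_(N j).+1 -> 'rV[R]_d -> 'rV[R]_d).
Variables (r p : forall j, 'I_(N j).+1 -> R).
Arguments Sm : clear implicits.
Arguments r : clear implicits.
Arguments p : clear implicits.
Hypothesis r_bounds : forall j k, 0 < r j k < 1.
Hypothesis Sm_sim : forall j k, similitude (r j k) (Sm j k).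
Hypothesis p_gt0 : forall j k, 0 < p j k.
Hypothesis p_sum : forall j, \sum_k p j k = 1.
Variables (K0 : set 'rV[R]_d) (eps : R).
Hypothesis K0_inv : invariant_compact Sm K0.
Hypothesis eps_gt0 : 0 < eps.
Hypothesis K0_sep : forall j (k1 k2 : 'I_(N j).+1), k1 != k2 ->
  forall x y, K0 x -> K0 y -> eps <= enorm (Sm j k1 x - Sm j k2 y).
Variable K : (nat -> 'I_m.+1) -> set 'rV[R]_d.
Hypothesis K_attr : is_random_attractor Sm K.
Variable mu : (nat -> 'I_m.+1) -> probability (borelRd R d) R.
Hypothesis mu_self : is_random_measure Sm p K mu.
Variable omega : nat -> 'I_m.+1.
Hypothesis omega_good : good_word theta omega.

Let lr := log_of r.
Let lp := log_of p.
Arguments lr : clear implicits.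
Arguments lp : clear implicits.

Let lr_lt0 j k : lr j k < 0.
Proof. exact: log_of_lt0. Qed.

Variables (q b alpha : R).
Hypothesis b_root : pressure theta lr lp q b = 0.
Hypothesis alpha_eq : gibbs_mean theta lr lp q b lp =
  alpha * gibbs_mean theta lr lp q b lr.

Hypothesis bq_ge0 : 0 <= b + alpha * q.

Let log_partition_deviation delta : 0 < delta -> exists C, forall n,
  `|\sum_(i < n) ln (partition_fun lr lp q b (omega i))| <= delta * n%:R + C.
Proof.
move=> d0; have [C CP] := omega_good (fun j => ln (partition_fun lr lp q b j)) d0.
exists C => n; have := CP n; rewrite -/(pressure theta lr lp q b) b_root.
by rewrite mulr0 subr0.
Qed.

(** The slack [t] between [s] and [b + alpha * q] is split: one half makes the sum over words decay,
    the other absorbs the distance of the symbolic dimension from [alpha]. *)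
Lemma level_set_meas_eq0 (A : set 'rV[R]_d) s :
  (forall x, A x -> K omega x /\ (upper_local_dim (mu omega) x = alpha%:E \/
     lower_local_dim (mu omega) x = alpha%:E)) ->
  b + alpha * q < s -> hausdorff_meas s A = 0%E.
Proof.
move=> AK bs; pose t := s - (b + alpha * q).
have t0 : 0 < t by rewrite subr_gt0.
have [c c0 cP] := exists_lr_bound r_bounds.
pose phi j k := potential lr lp q (b + t / 2) (k : 'I_(N j).+1).
(* The tilt gains [c * t / 2] per digit; the partition functions may use up half of it. *)
have ct0 : 0 < c * t / 4 by rewrite divr_gt0// mulr_gt0.
have [C CP] := log_partition_deviation ct0.
apply: (@hausdorff_meas_eq0 R d m N Sm r r_bounds Sm_sim K0 K0_inv omega phi s A
  (expR C) (expR (- (c * t / 4)))).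
- by rewrite (le_trans bq_ge0)// ltW.
- by rewrite expR_gt0 expR_lt1 oppr_lt0.
- move=> n; rewrite sum_words_expR_birkhoff.
  apply: (@le_trans _ _ (\prod_(i < n) (partition_fun lr lp q b (omega i) *
      expR (- (c * t / 2))))).
    apply: ler_prod => i _; rewrite sumr_ge0 /=; last by move=> k _; exact: expR_ge0.
    rewrite mulr_suml ler_sum// => k _; rewrite -expRD ler_expR /phi /potential.
    have := ler_wpM2l (ltW (divr_gt0 t0 (ltr0Sn R 1))) (cP (omega i) k).
    by rewrite -/lr; lra.
  rewrite big_split /= prodr_const card_ord.
  have -> : \prod_(i < n) partition_fun lr lp q b (omega i) =
      expR (\sum_(i < n) ln (partition_fun lr lp q b (omega i))).
    by rewrite expR_sum; apply: eq_bigr => i _; rewrite lnK// posrE partition_fun_gt0.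
  rewrite -!expRM_natr -!expRD ler_expR.
  by have := CP n; rewrite ler_norml => /andP[_]; lra.
- move=> x /AK[Kx xa] M.
  have [k vk ck] := exists_code r_bounds Sm_sim K0_inv eps_gt0 K0_sep K_attr Kx.
  (* Chosen so that [q] times the error is at most [t / 2]; below, [M.+1] excludes [n = 0], where
     the denominator vanishes. *)
  pose delta := t / (2 * (`|q| + 1)).
  have q1 : 0 < `|q| + 1 by rewrite ltr_wpDl.
  have d0 : 0 < delta by rewrite divr_gt0// mulr_gt0.
  have [n Mn nP] := symbolic_dim_frequently r_bounds Sm_sim p_gt0 K0_inv eps_gt0
    K0_sep K_attr mu_self vk ck xa M.+1 d0.
  exists (mkseq k n); rewrite size_mkseq; split.
  + exact: ltnW.
  + exact: valid_mkseq.
  + have [c1 c10 c1P] := birkhoff_lr_le r_bounds.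
    have B0 : birkhoff lr omega (mkseq k n) < 0.
      rewrite (le_lt_trans (c1P _ _ _))// oppr_lt0 mulr_gt0// ltr0n.
      exact: leq_ltn_trans Mn.
    rewrite /phi /potential birkhoffD !birkhoffZ.
    set P := birkhoff lp _ _; set B := birkhoff lr _ _ in B0 *.
    have PE : P = symbolic_dim r p omega k n * B by rewrite /symbolic_dim divfK// lt_eqF.
    rewrite PE mulrA -mulrDl ler_nM2r//.
    have : `|q * (symbolic_dim r p omega k n - alpha)| <= t / 2.
      rewrite normrM (le_trans (ler_wpM2l (normr_ge0 q) nP))// /delta.
      rewrite mulrA ler_pdivrMr ?mulr_gt0// mulrC.
      have -> : t / 2 * (2 * (`|q| + 1)) = t * (`|q| + 1) by field.
      by rewrite ler_pM2l// lerDl.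
    rewrite ler_norml => /andP[_].
    by rewrite /t; lra.
  + by have [y Ky xy] := ck n; exists y.
Qed.

(** Along good codes for the Gibbs weights, the vanishing pressure and [alpha_eq] make the logarithm
    of the cylinder mass equal to [b + alpha * q] times that of the ratio, up to errors of
    arbitrarily small slope. *)
Lemma level_set_meas_neq0 (A : set 'rV[R]_d) s :
  level_set (mu omega) (K omega) alpha `<=` A ->
  0 <= s < b + alpha * q -> hausdorff_meas s A != 0%E.
Proof.
move=> LA /andP[s0 sb].
pose w j (k : 'I_(N j).+1) := gibbs lr lp q b k.
(* The logarithm of the Gibbs weight, bracketed as a sum of scalar multiples so that its Birkhoff
   sum splits. *)
pose lw j (k : 'I_(N j).+1) :=
  q * lp j k + (b * lr j k + - 1 * ln (partition_fun lr lp q b j)).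
have w0 j k : 0 <= w j k by exact/ltW/gibbs_gt0.
have w1 j : \sum_k w j k = 1 by exact: gibbs_sum.
have [C CP] := exists_good_code w0 w1 lp lr.
pose G k := (forall delta n, 0 < delta ->
    `|birkhoff (centered w lp) omega (mkseq k n)| <= delta * n%:R + C delta) /\
  (forall delta n, 0 < delta ->
    `|birkhoff (centered w lr) omega (mkseq k n)| <= delta * n%:R + C delta).
(* An exponent above [s], as the mass estimate requires, and still below [b + alpha * q], which
   leaves a linear margin. *)
pose s1 := (s + (b + alpha * q)) / 2.
have s1P : s < s1 < b + alpha * q by rewrite /s1; apply/andP; split; lra.
have /andP[ss1 s1b] := s1P.
have [c c0 cP] := gibbs_mean_lr_le theta_gt0 theta_sum lp lr_lt0.
have L0 : gibbs_mean theta lr lp q b lr < 0.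
  by rewrite (le_lt_trans (cP q b))// oppr_lt0.
(* The errors from [lp], [lr] and the partition functions together use up exactly this margin. *)
have [e e0 eH] : exists2 e, 0 < e & e * (`|q| + `|b - s1| + 1) =
    - (gibbs_mean theta lr lp q b lr * (b + alpha * q - s1)).
  have H0 : 0 < `|q| + `|b - s1| + 1 by rewrite ltr_wpDl// addr_ge0.
  exists (- (gibbs_mean theta lr lp q b lr * (b + alpha * q - s1)) /
    (`|q| + `|b - s1| + 1)); last by rewrite divfK// gt_eqF.
  by rewrite divr_gt0// oppr_gt0 nmulr_rlt0// subr_gt0.
have [Cp CpP] := birkhoff_good_code omega_good w lp C e0.
have [Cr CrP] := birkhoff_good_code omega_good w lr C e0.
have [Cz CzP] := log_partition_deviation e0.
apply: (@hausdorff_meas_neq0 R d m N Sm r r_bounds Sm_sim K0 eps K0_inv eps_gt0 K0_sep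
  omega w lw G A s s1 (`|q| * Cp + `|b - s1| * Cr + Cz)).
- move=> j k; rewrite w0 /= -[leLHS](@lnK R) ?posrE; last exact: gibbs_gt0.
  by rewrite ler_expR ln_gibbs /lw /potential mulN1r addrA.
- by rewrite s0.
- move=> k n [/CpP/(_ n) hp /CrP/(_ n) hr].
  have hz := CzP n.
  have -> : birkhoff lw omega (mkseq k n) = q * birkhoff lp omega (mkseq k n) +
     (b * birkhoff lr omega (mkseq k n) -
      \sum_(i < n) ln (partition_fun lr lp q b (omega i))).
    rewrite /lw birkhoffD birkhoffZ birkhoffD birkhoffZ birkhoffZ.
    by rewrite birkhoff_letter size_mkseq mulN1r.
  rewrite -[\sum_j theta j * wmean w lp j]/(gibbs_mean theta lr lp q b lp) in hp.
  rewrite -[\sum_j theta j * wmean w lr j]/(gibbs_mean theta lr lp q b lr) in hr.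
  rewrite alpha_eq in hp.
  move: hp hr hz; rewrite -/lr; set P := birkhoff lp _ _; set B := birkhoff lr _ _.
  set Z := \sum_(_ < _) _; move: eH.
  set L := gibbs_mean _ _ _ _ _ _ => eH hp hr hz.
  have h1 : q * (P - n%:R * (alpha * L)) <= `|q| * (e * n%:R + Cp).
    by rewrite (le_trans (ler_norm _))// normrM ler_wpM2l.
  have h2 : (b - s1) * (B - n%:R * L) <= `|b - s1| * (e * n%:R + Cr).
    by rewrite (le_trans (ler_norm _))// normrM ler_wpM2l.
  have h3 : - Z <= e * n%:R + Cz.
    by rewrite (le_trans _ hz)// -normrN ler_norm.
  have e1 : `|q| * (e * n%:R) + `|b - s1| * (e * n%:R) + e * n%:R =
      - (L * (b + alpha * q - s1)) * n%:R by rewrite -eH; ring.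
  move: h1 h2 h3 e1.
  move: `|q| `|b - s1| => u v h1 h2 h3 e1.
  by lra.
- move=> k x vk [gp gr] ck; apply: LA; split.
    exact: (codes_attractor Sm_sim K0_inv K_attr vk ck).
  apply: (has_local_dim_of_good_code r_bounds Sm_sim p_gt0 K0_inv eps_gt0 K0_sep
    K_attr mu_self omega_good (w := w) _ vk ck gp gr).
  exact: alpha_eq.
- move=> bb cc /CP[k [vk gp gr av]]; exists k; split => //.
Qed.

(** Stated for any set between the level set and the union of the upper and lower level sets, so
    that all three dimensions come from one argument. *)
Lemma hausdorff_dim_level (A : set 'rV[R]_d) :
  level_set (mu omega) (K omega) alpha `<=` A ->
  (forall x, A x -> K omega x /\ (upper_local_dim (mu omega) x = alpha%:E \/
     lower_local_dim (mu omega) x = alpha%:E)) ->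
  hausdorff_dim A = (b + alpha * q)%:E.
Proof.
move=> LA AK; apply/eqP; rewrite eq_le; apply/andP; split.
  apply/lee_addgt0Pr => e e0; rewrite -EFinD; apply: ereal_inf_lbound.
  exists (b + alpha * q + e) => //=; split; first by rewrite addr_ge0// ltW.
  by apply: level_set_meas_eq0 => //; rewrite ltrDl.
apply: le_ereal_inf_tmp => _ [s [/= s0 sA] <-]; rewrite lee_fin leNgt.
apply/negP => sb; have := @level_set_meas_neq0 A s LA.
by rewrite s0 sb sA eqxx => /(_ isT).
Qed.

End level_sets.

Section log_ratio.
Variables (R : realType) (m : nat) (theta : 'I_m.+1 -> R) (N : 'I_m.+1 -> nat).
Variables (r p : forall j, 'I_(N j).+1 -> R).
Arguments r : clear implicits.
Arguments p : clear implicits.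
Hypothesis r_gt0 : forall j k, 0 < r j k.
Hypothesis p_gt0 : forall j k, 0 < p j k.

Lemma log_ratioE k : log_ratio theta r p k = tuple_ratio theta (log_of r) (log_of p) k.
Proof.
have lnE (f : forall j, 'I_(N j).+1 -> R) : (forall j a, 0 < f j a) ->
    ln (\prod_j (f j (k j) `^ theta j)) = tuple_mean theta (log_of f) k.
  move=> f0; rewrite (eq_bigr (fun j => expR (theta j * ln (f j (k j))))).
    by rewrite -expR_sum expRK.
  by move=> j _; rewrite powR_exp.
by rewrite /log_ratio !lnE.
Qed.

Lemma alpha_maxP : (forall k, log_ratio theta r p k <= alpha_max theta r p) /\
  exists k, alpha_max theta r p = log_ratio theta r p k.
Proof.
split=> [k|]; first exact: le_bigmax.
pose k := [arg max_(k > dffun0 N) log_ratio theta r p k]%O.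
have kP t : log_ratio theta r p t <= log_ratio theta r p k.
  by rewrite /k; case: arg_maxP => // i _; apply.
exists k; apply/eqP; rewrite eq_le le_bigmax andbT.
by apply: bigmax_le => [|t _]; exact: kP.
Qed.

Lemma alpha_minP : (forall k, alpha_min theta r p <= log_ratio theta r p k) /\
  exists k, alpha_min theta r p = log_ratio theta r p k.
Proof.
split=> [k|]; first exact: bigmin_le.
pose k := [arg min_(k < dffun0 N) log_ratio theta r p k]%O.
have kP t : log_ratio theta r p k <= log_ratio theta r p t.
  by rewrite /k; case: arg_minP => // i _; apply.
exists k; apply/eqP; rewrite eq_le bigmin_le /=.
by apply: le_bigmin => [|t _]; exact: kP.
Qed.

End log_ratio.

Theorem theorem3p3 (R : realType) (d m : nat)
  (theta : 'I_m.+1 -> R)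
  (theta_gt0 : forall j, 0 < theta j)
  (theta_sum : \sum_j theta j = 1)
  (P : probability (words m) R)
  (P_bernoulli : is_bernoulli theta P)
  (N : 'I_m.+1 -> nat)
  (S : forall j, 'I_(N j).+1 -> 'rV[R]_d -> 'rV[R]_d)
  (r p : forall j, 'I_(N j).+1 -> R)
  (r_bounds : forall j k, 0 < r j k < 1)
  (S_similitude : forall j k, similitude (r j k) (S j k))
  (p_gt0 : forall j k, 0 < p j k)
  (p_sum : forall j, \sum_k p j k = 1)
  (K : (nat -> 'I_m.+1) -> set 'rV[R]_d)
  (K_attractor : is_random_attractor S K)
  (mu : (nat -> 'I_m.+1) -> probability (borelRd R d) R)
  (mu_selfsimilar : is_random_measure S p K mu)
  (S_ussc : ussc S)
  (beta : R -> R)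
  (beta_eq : is_beta theta r p beta) :
  [/\ {ae P, forall omega : words m,
        [/\ [set a%:E | a in `[alpha_min theta r p, alpha_max theta r p]] =
              [set a : \bar R |
                exists2 x, K omega x & has_local_dim (mu omega) x a],
            [set a%:E | a in `[alpha_min theta r p, alpha_max theta r p]] =
              [set lower_local_dim (mu omega) x | x in K omega] &
            [set a%:E | a in `[alpha_min theta r p, alpha_max theta r p]] =
              [set upper_local_dim (mu omega) x | x in K omega]]},
      (forall alpha : R,
        alpha_min theta r p < alpha < alpha_max theta r p ->
        exists q_alpha : R,
          [/\ derivable beta q_alpha 1,
              alpha = - beta^`()%classic q_alpha &
              {ae P, forall omega : words m,
                [/\ hausdorff_dim (level_set (mu omega) (K omega) alpha) =
                      ereal_inf
                        (range (fun q : R => (beta q + alpha * q)%:E)),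
                    ereal_inf (range (fun q : R => (beta q + alpha * q)%:E)) =
                      (beta q_alpha - beta^`()%classic q_alpha * q_alpha)%:E,
                    (beta q_alpha - beta^`()%classic q_alpha * q_alpha)%:E =
                      hausdorff_dim
                        (lower_level_set (mu omega) (K omega) alpha) &
                    (beta q_alpha - beta^`()%classic q_alpha * q_alpha)%:E =
                      hausdorff_dim
                        (upper_level_set (mu omega) (K omega) alpha)]}]) &
      @convex_function R R^o setT beta].
Proof.
have r_gt0 j k : 0 < r j k by have /andP[] := r_bounds j k.
have [K0 [K0_inv _ [eps eps0 K0_sep]]] := S_ussc.
pose lr := log_of r; pose lp := log_of p.
have lr_lt0 j k : lr j k < 0 by exact: log_of_lt0.
have beta_root q : pressure theta lr lp q (beta q) = 0.
  rewrite -(beta_eq q) /pressure; apply: eq_bigr => j _; congr (_ * ln _).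
  by apply: eq_bigr => k _; rewrite expRD -!powR_exp.
have [ge_min [kmin minE]] := alpha_minP theta r p.
have [le_max [kmax maxE]] := alpha_maxP theta r p.
have good := ae_good_word theta_gt0 theta_sum P_bernoulli.
have aeF : Filter (nbhs (almost_everywhere P)) by exact: ae_filter_ringOfSetsType.
split; last exact: (beta_convex theta_gt0 theta_sum lr_lt0 beta_root).
- apply: filterS good => omega omega_good.
  set a := alpha_min _ _ _; set b := alpha_max _ _ _.
  have attained c : c \in `[a, b] -> exists2 x, K omega x & has_local_dim (mu omega) x c%:E.
    rewrite in_itv /= {1}/a {1}/b minE maxE !log_ratioE//.
    exact: (exists_has_local_dim theta_gt0 r_bounds S_similitude p_gt0 K0_inv eps0
      K0_sep K_attractor mu_selfsimilar omega_good).
  have bounds x : K omega x ->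
    [/\ exists2 l, l \in `[a, b] & lower_local_dim (mu omega) x = l%:E,
    exists2 l, l \in `[a, b] & upper_local_dim (mu omega) x = l%:E &
    forall l, has_local_dim (mu omega) x l -> exists2 l', l' \in `[a, b] & l = l'%:E].
    move=> Kx.
    have [k vk ck] := exists_code r_bounds S_similitude K0_inv eps0 K0_sep K_attractor Kx.
    apply: (local_dim_bounds r_bounds S_similitude p_gt0 K0_inv eps0 K0_sep
      K_attractor mu_selfsimilar vk ck).
    apply: (symbolic_dim_range theta_gt0 r_bounds omega_good) => t.
    by rewrite -log_ratioE// ge_min le_max.
  split; apply/seteqP; split => [_ [c /= cab <-]|].
  + exact: attained.
  + by move=> c [x /bounds[_ _ h]] /h[l lab ->]; exists l.
  + have [x Kx xc] := attained c cab; exists x => //.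
    by have [] := upper_lower_of_has_local_dim xc.
  + by move=> _ [x /bounds[[l lab ->] _ _] <-]; exists l.
  + have [x Kx xc] := attained c cab; exists x => //.
    by have [] := upper_lower_of_has_local_dim xc.
  + by move=> _ [x /bounds[_ [l lab ->] _] <-]; exists l.
move=> alpha; rewrite minE maxE !log_ratioE// => alphab.
have [q [alphaE qmin q0]] := exists_tangent theta_gt0 theta_sum lr_lt0 beta_root alphab.
exists q; have dq := beta_is_derive theta_gt0 theta_sum lr_lt0 beta_root q.
have dE := derive1_beta theta_gt0 theta_sum lr_lt0 beta_root q.
have [c c0 cP] := gibbs_mean_lr_le theta_gt0 theta_sum lp lr_lt0.
have L0 : gibbs_mean theta lr lp q (beta q) lr < 0.
  by rewrite (le_lt_trans (cP _ _))// oppr_lt0.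
have meanE : gibbs_mean theta lr lp q (beta q) lp =
    alpha * gibbs_mean theta lr lp q (beta q) lr.
  by rewrite alphaE /beta_slope opprK divfK// lt_eqF.
split.
- exact: (@ex_derive _ _ _ _ _ _ _ dq).
- by rewrite dE.
apply: filterS good => omega omega_good.
have valE : beta q - beta^`()%classic q * q = beta q + alpha * q.
  by rewrite dE alphaE; move: (beta_slope _ _ _ _ _) => s; rewrite mulNr.
have dim A := @hausdorff_dim_level R d m theta theta_gt0 theta_sum N S r p r_bounds
  S_similitude p_gt0 K0 eps K0_inv eps0 K0_sep K K_attractor mu mu_selfsimilar omega
  omega_good q (beta q) alpha (beta_root q) meanE q0 A.
have infE : ereal_inf (range (fun q : R => (beta q + alpha * q)%:E)) =
    (beta q + alpha * q)%:E.
  apply/eqP; rewrite eq_le; apply/andP; split.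
    by apply: ereal_inf_lbound; exists q.
  by apply: le_ereal_inf_tmp => _ [q' _ <-]; rewrite lee_fin.
have level x : level_set (mu omega) (K omega) alpha x -> K omega x /\
    lower_local_dim (mu omega) x = alpha%:E /\ upper_local_dim (mu omega) x = alpha%:E.
  by move=> [Kx xa]; split => //; exact: upper_lower_of_has_local_dim.
rewrite valE infE; split => //; [|apply/esym|apply/esym]; apply: dim => x.
- by [].
- by move=> /level[? []]; split => //; left.
- by move=> /level[? []].
- by move=> [? ?]; split => //; right.
- by move=> /level[? []].
- by move=> [? ?]; split => //; left.
Qed.
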